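(* Let $d\in\mathbb{N}$. For each $n\in\mathbb{N}$ let $Y^{(n)}=(Y^{(n)}_0,Y^{(n)}_1,Y^{(n)}_2,\ldots)$ be a time homogeneous Markov chain with values in $\mathbb{R}^d$, let $X^{n,J_1}$ be its step function embedding, i.e. $X^{n,J_1}_t=Y^{(n)}_{\lfloor nt\rfloor}$ for $t\in[0,1)$ and $X^{n,J_1}_1=\lim_{t\uparrow 1}X^{n,J_1}_t=Y^{(n)}_{n-1}$, and let $X$ be a $D[0,1]$-valued random variable. Suppose that the following conditions hold: 1. $X^{n,J_1}\xrightarrow{\text{fdd}}X$ on a dense subset of $[0,1]$; 2. for all $\varepsilon>0$ and all $m\in\mathbb{N}$ there exists $R>0$ such that $$\sup_n \mathbb{P}\Big(\sup_{t\in[0,1]}\big|Y^{(n)}_{\lfloor tnm\rfloor}\big|>R\Big)<\varepsilon;$$ 3. for all $\varepsilon>0$ and all $R>0$ $$\lim_{h\downarrow 0}\limsup_{n\to\infty}\sup_{|x|<R,\ 0\le t\leq h}\mathbb{P}\Big(\big|Y^{(n)}_{\lfloor tn\rfloor}-x\big|>\varepsilon\,\Big|\,Y^{(n)}_0=x\Big)=0.$$ Then $X^{n,J_1}\xrightarrow{d}X$ with respect to $J_1$.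
   Context: $D[0,1]$ is the set of functions $f:[0,1]\to\mathbb{R}^d$ that are right continuous with left limits and left continuous at $1$. It carries the $J_1$ metric $d_{J_1}(f_1,f_2)=\inf_{\lambda\in\Lambda_c}\{\|f_1\circ\lambda-f_2\|_\infty\vee\|\lambda-\mathrm{id}\|_\infty\}$, where $\Lambda_c$ is the set of continuous bijections $\lambda:[0,1]\to[0,1]$ and $\|\cdot\|_\infty$ is the supremum norm. $D[0,1]$-valued random variables are measurable with respect to the Borel $\sigma$-algebra of the $J_1$ topology (which is generated by the coordinate evaluations). $X^{(n)}\xrightarrow{d}X$ with respect to $J_1$ means $\mathbb{E}(G(X^{(n)}))\to\mathbb{E}(G(X))$ for all bounded $J_1$-continuous $G:D[0,1]\to\mathbb{R}$. $X^{(n)}\xrightarrow{\text{fdd}}X$ on $I\subset[0,1]$ means that $(X^{(n)}_{t_1},\ldots,X^{(n)}_{t_k})\to(X_{t_1},\ldots,X_{t_k})$ in distribution for all $k\in\mathbb{N}$ and $t_1,\ldots,t_k\in I$. $\mathbb{P}(\,\cdot\,|\,Y^{(n)}_0=x)$ denotes the law of the Markov chain with the transition kernel of $Y^{(n)}$ started at $x\in\mathbb{R}^d$. *)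

(* Defs.v *)
From HB Require Import structures.
From mathcomp Require Import all_boot all_order all_algebra.
From mathcomp Require Import all_classical all_reals all_analysis.
From mathcomp Require Import ring lra.

Set Implicit Arguments.
Unset Strict Implicit.
Unset Printing Implicit Defensive.

Import Order.TTheory GRing.Theory Num.Theory.
Import numFieldNormedType.Exports.

Local Open Scope classical_set_scope.
Local Open Scope ring_scope.

(* The library's norm on row vectors is the maximum norm. *)
Definition enorm (R : realType) (d : nat) (x : 'rV[R]_d) : R :=
  Num.sqrt (\sum_(i < d) x 0 i ^+ 2).

Section enorm_theory.
Context {R : realType} {d : nat}.
Implicit Types x y z : 'rV[R]_d.

Lemma enorm_ge0 x : 0 <= enorm x.
Proof. exact: sqrtr_ge0. Qed.

Lemma sqr_enorm x : enorm x ^+ 2 = \sum_(i < d) x 0 i ^+ 2.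
Proof. by rewrite sqr_sqrtr// sumr_ge0// => i _; exact: sqr_ge0. Qed.

Lemma enorm0 : enorm (0 : 'rV[R]_d) = 0.
Proof.
rewrite /enorm big1 ?sqrtr0// => i _.
by rewrite mxE expr0n.
Qed.

Lemma enormN x : enorm (- x) = enorm x.
Proof. by congr Num.sqrt; apply: eq_bigr => i _; rewrite mxE sqrrN. Qed.

Lemma enorm_eq0 x : enorm x = 0 -> x = 0.
Proof.
move=> x0; have : \sum_(i < d) x 0 i ^+ 2 = 0 by rewrite -sqr_enorm x0 expr0n.
move/eqP; rewrite psumr_eq0 => [/allP xi0|i _]; last exact: sqr_ge0.
apply/rowP => i; rewrite mxE; apply/eqP.
by rewrite -sqrf_eq0; apply: xi0; rewrite mem_index_enum.
Qed.

Lemma dot_le_enorm x y : \sum_(i < d) x 0 i * y 0 i <= enorm x * enorm y.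
Proof.
set a := enorm x; set b := enorm y; set s := \sum_(i < d) _.
have [a0|a0] := eqVneq a 0.
  rewrite /s (enorm_eq0 a0) big1 ?a0 ?mul0r// => i _.
  by rewrite mxE mul0r.
have [b0|b0] := eqVneq b 0.
  rewrite /s (enorm_eq0 b0) big1 ?b0 ?mulr0// => i _.
  by rewrite mxE mulr0.
have ab0 : 0 < a * b by rewrite mulr_gt0// lt0r ?a0 ?b0 enorm_ge0.
have : 0 <= \sum_(i < d) (b * x 0 i - a * y 0 i) ^+ 2.
  by rewrite sumr_ge0// => i _; exact: sqr_ge0.
have -> : \sum_(i < d) (b * x 0 i - a * y 0 i) ^+ 2 =
    b ^+ 2 * (\sum_(i < d) x 0 i ^+ 2) + a ^+ 2 * (\sum_(i < d) y 0 i ^+ 2) +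
    (- (2 * a * b)) * s.
  rewrite /s !mulr_sumr -!big_split/=.
  by apply: eq_bigr => i _; ring.
rewrite -!sqr_enorm -/a -/b => h.
have : 0 <= (a * b) * (a * b - s) by nra.
by rewrite pmulr_rge0// subr_ge0.
Qed.

Lemma ler_enormD x y : enorm (x + y) <= enorm x + enorm y.
Proof.
rewrite -(@ler_pXn2r _ 2%N)// ?nnegrE ?addr_ge0 ?enorm_ge0//.
have -> : enorm (x + y) ^+ 2 =
    enorm x ^+ 2 + enorm y ^+ 2 + 2 * (\sum_(i < d) x 0 i * y 0 i).
  rewrite !sqr_enorm mulr_sumr -!big_split/=.
  by apply: eq_bigr => i _; rewrite mxE; ring.
by have := dot_le_enorm x y; nra.
Qed.

End enorm_theory.

Notation unit_itv R := [set t : R | 0 <= t <= 1].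

Section unit_itv_theory.
Context {R : realType}.
Local Notation I := (unit_itv R).

Lemma unit_itvP (t : I) : 0 <= val t <= 1.
Proof. by have := set_valP t. Qed.

Lemma unit_itv_cvg_const (T : topologicalType) (f : I -> T) (t : I)
    (A : set I) (l : T) (e : R) :
  0 < e -> (forall s, A s -> `|val t - val s| < e -> f s = l) ->
  f @ within A (nbhs t) --> l.
Proof.
move=> e0 fl U lU; change (nbhs t [set s | A s -> U (f s)]).
have vt : nbhs (val t : R) (ball (val t : R) e) by exact: nbhsx_ballx.
have : nbhs t (set_val @^-1` ball (val t : R) e).
  exact: (@initial_continuous I R set_val t _ vt).
apply: filterS => s /= st As; rewrite (fl s As).
  exact: nbhs_singleton lU.
by move: st; rewrite /ball/= set_valE.
Qed.

Lemma compact_unit_itv : compact [set: I].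
Proof.
have c01 : compact I.
  have -> : I = `[0, 1]%classic :> set R.
    by apply/seteqP; split => t /=; rewrite in_itv.
  exact: segment_compact.
move=> F FF _.
pose G : set_system R := [set B | F (val @^-1` B)].
have FG : ProperFilter G by exact: fmap_proper_filter.
have GI : G I.
  by rewrite /G/=; apply: filterS filterT => t _ /=; exact: unit_itvP.
have [x [Ix clx]] := c01 G FG GI.
exists (SigSub (mem_set Ix)); split => // A B FA [_ [[W oW <-] Wx WB]].
have [_ [[t At <-] Wt]] := clx (val @` A) W
  (filterS (@preimage_image _ _ val A) FA)
  (open_nbhs_nbhs (conj oW Wx)).
by exists t; split => //; exact: WB.
Qed.

Lemma hausdorff_unit_itv : hausdorff_space I.
Proof.
move=> s t st; apply/val_inj/(@Rhausdorff R) => A B sA tB.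
have cv := @initial_continuous I R set_val.
by have [u [Au Bu]] := st _ _ (cv s _ sA) (cv t _ tB); exists (set_val u).
Qed.

End unit_itv_theory.

(* Continuous bijections of [0,1], not required to be increasing. *)
Definition time_change (R : realType) :
    set (unit_itv R -> unit_itv R) :=
  [set l : unit_itv R -> unit_itv R | bijective l /\ continuous l].

Section time_change_theory.
Context {R : realType}.
Implicit Types l k : unit_itv R -> unit_itv R.

Lemma time_change_id : time_change (@id (unit_itv R)).
Proof. by split; [exists id | move=> t]. Qed.

Lemma time_change_comp l k :
  time_change l -> time_change k -> time_change (l \o k).
Proof.
move=> [bl cl] [bk ck]; split; first exact: bij_comp.
by move=> t; apply: continuous_comp; [exact: ck|exact: cl].
Qed.

Lemma time_change_inv l :
  time_change l -> exists2 k, time_change k & cancel k l.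
Proof.
move=> [[k lk kl] cl]; exists k => //; split; first by exists l.
apply/continuous_closedP => C cC.
have -> : k @^-1` C = l @` C.
  apply/seteqP; split => [t Ct|_ [t Ct <-]]/=; last by rewrite lk.
  by exists (k t) => //; exact: kl.
apply: compact_closed; first exact: hausdorff_unit_itv.
apply: continuous_compact; first exact: continuous_subspaceT.
exact: subclosed_compact cC compact_unit_itv _.
Qed.

End time_change_theory.

Record D01 (R : realType) (d : nat) := MkD01 {
  D01_fun :> unit_itv R -> 'rV[R]_d ;
  D01_right_continuous : forall t : unit_itv R,
    D01_fun @ within [set s : unit_itv R | val t < val s] (nbhs t) --> D01_fun t ;
  D01_left_limit : forall t : unit_itv R, exists l : 'rV[R]_d,
    D01_fun @ within [set s : unit_itv R | val s < val t] (nbhs t) --> l ;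
  D01_left_continuous_at1 : forall t : unit_itv R, val t = 1 ->
    D01_fun @ within [set s : unit_itv R | val s < val t] (nbhs t) --> D01_fun t }.

Section D01_pointed.
Context {R : realType} {d : nat}.

Definition cst_D01 (v : 'rV[R]_d) : D01 R d :=
  @MkD01 R d (fun=> v) (fun t => cvg_cst v)
    (fun t => ex_intro _ v (cvg_cst v)) (fun t _ => cvg_cst v).

HB.instance Definition _ := gen_eqMixin (D01 R d).
HB.instance Definition _ := gen_choiceMixin (D01 R d).
HB.instance Definition _ := isPointed.Build (D01 R d) (cst_D01 0).

End D01_pointed.

Section J1.
Context {R : realType} {d : nat}.
Implicit Types f g h : D01 R d.

Definition sup_norm (T : Type) (u : T -> R) : \bar R :=
  ereal_sup [set (u t)%:E | t in [set: T]].

Definition J1_dist f g : \bar R := ereal_inf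
  [set maxe (sup_norm (fun t => enorm (f (l t) - g t)))
            (sup_norm (fun t => `|val (l t) - val t|)) | l in @time_change R].

Lemma J1_dist_ltP f g (e : R) : (J1_dist f g < e%:E)%E <->
  exists l a, [/\ time_change l, a < e,
    forall t, enorm (f (l t) - g t) <= a &
    forall t, `|val (l t) - val t| <= a].
Proof.
have supP (u : unit_itv R -> R) a :
    (sup_norm u <= a%:E)%E <-> forall t, u t <= a.
  split=> [ua t|ua]; last first.
    by apply: ge_ereal_sup => _ [t _ <-]; rewrite lee_fin.
  rewrite -lee_fin; apply: le_trans ua.
  by apply: ereal_sup_ubound; exists t.
split=> [|[l [a [lL ae fa la]]]].
  move=> /ereal_inf_lt [_ [l lL <-]].
  set m := maxe _ _ => me.
  have m0 : (0%:E <= m)%E.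
    rewrite le_max; apply/orP; right.
    have t0 : unit_itv R by exists 0; apply: mem_set => /=; rewrite lexx ler01.
    apply: (@le_trans _ _ (`|val (l t0) - val t0|)%:E); first by rewrite lee_fin.
    by apply: ereal_sup_ubound; exists t0.
  have mfin : m \is a fin_num.
    by rewrite ge0_fin_numE// (lt_trans me)// ltry.
  have mm : (m <= (fine m)%:E)%E by rewrite fineK.
  exists l, (fine m); split => //; first by rewrite -lte_fin fineK.
    by apply/supP; apply: le_trans mm; rewrite le_max lexx.
  by apply/supP; apply: le_trans mm; rewrite le_max lexx orbT.
apply: (@le_lt_trans _ _ a%:E); last by rewrite lte_fin.
apply: (@le_trans _ _ (maxe (sup_norm (fun t => enorm (f (l t) - g t)))
            (sup_norm (fun t => `|val (l t) - val t|)))).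
  by apply: ereal_inf_lbound; exists l.
by rewrite ge_max; apply/andP; split; apply/supP.
Qed.

Definition J1_ball f (e : R) : set (D01 R d) :=
  [set g | (J1_dist f g < e%:E)%E].

Lemma J1_ball_center f (e : R) : 0 < e -> J1_ball f e f.
Proof.
move=> e0; apply/J1_dist_ltP; exists id, 0; split => // [|t|t].
- exact: time_change_id.
- by rewrite subrr enorm0.
- by rewrite subrr normr0.
Qed.

Lemma J1_ball_sym f g (e : R) : J1_ball f e g -> J1_ball g e f.
Proof.
move=> /J1_dist_ltP[l [a [lL ae fa la]]]; apply/J1_dist_ltP.
have [k kL kl] := time_change_inv lL; exists k, a; split => // t.
- by rewrite -enormN opprB -{1}(kl t).
- by rewrite distrC -{1}(kl t).
Qed.

Lemma J1_ball_triangle f g h (e1 e2 : R) :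
  J1_ball f e1 g -> J1_ball g e2 h -> J1_ball f (e1 + e2) h.
Proof.
move=> /J1_dist_ltP[l [a [lL ae fa la]]] /J1_dist_ltP[k [b [kL be gb kb]]].
apply/J1_dist_ltP; exists (l \o k), (a + b); split.
- exact: time_change_comp.
- exact: ltrD.
- move=> t /=; rewrite (_ : _ - _ =
    (f (l (k t)) - g (k t)) + (g (k t) - h t)); last by rewrite addrA subrK.
  by rewrite (le_trans (ler_enormD _ _))// lerD.
- move=> t /=; rewrite (_ : _ - _ =
    (val (l (k t)) - val (k t)) + (val (k t) - val t)); last first.
    by rewrite addrA subrK.
  by rewrite (le_trans (ler_normD _ _))// lerD.
Qed.

HB.instance Definition _ := hasNbhs.Build (D01 R d)
  (nbhs_ (entourage_ J1_ball)).

HB.instance Definition _ := @Nbhs_isPseudoMetric.Build R (D01 R d)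
  (entourage_ J1_ball) erefl J1_ball
  J1_ball_center J1_ball_sym J1_ball_triangle erefl.

End J1.

Notation borel T := (g_sigma_algebraType (@open T)).

(* t |-> y_(floor (n t)) on [0,1), extended to 1 by its left limit. *)
Section step_function.
Context {R : realType} {d : nat} (n : nat) (y : nat -> 'rV[R]_d).

Definition step_fun (t : unit_itv R) : 'rV[R]_d :=
  if val t < 1 then y (Num.truncn (n%:R * val t)) else y n.-1.

Lemma step_fun_right (t : unit_itv R) :
  step_fun @ within [set s : unit_itv R | val t < val s] (nbhs t) --> step_fun t.
Proof.
have /andP[t0 t1] := unit_itvP t.
have [tlt1|tge1] := ltP (val t) 1; last first.
  apply: (unit_itv_cvg_const (e := 1)) => // s ts _.
  have {}ts : val t < val s := ts.
  by have /andP[_] := unit_itvP s; rewrite leNgt (le_lt_trans tge1 ts).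
have nt0 : 0 <= n%:R * val t :> R by rewrite mulr_ge0.
have /andP[kle ltk] := truncn_itv nt0.
set k := Num.truncn (n%:R * val t) in kle ltk *.
pose e := Num.min (1 - val t) ((k.+1%:R - n%:R * val t) / n.+1%:R).
have e0 : 0 < e by rewrite lt_min subr_gt0 tlt1 divr_gt0// subr_gt0.
apply: (unit_itv_cvg_const e0) => s ts.
have {}ts : val t < val s := ts.
rewrite distrC gtr0_norm ?subr_gt0// lt_min => /andP[s1].
rewrite ltr_pdivlMr// -[n.+1%:R]natr1 => sk.
have slt1 : val s < 1 by lra.
rewrite /step_fun tlt1 slt1 -/k; congr y; apply: truncn_def.
have nst : 0 <= n%:R * (val s - val t) by rewrite mulr_ge0// subr_ge0 ltW.
by apply/andP; split; lra.
Qed.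

Lemma step_fun_left (t : unit_itv R) (m : nat) :
  m%:R < n%:R * val t <= m.+1%:R ->
  step_fun @ within [set s : unit_itv R | val s < val t] (nbhs t) --> y m.
Proof.
move=> /andP[mt tm]; have /andP[t0 t1] := unit_itvP t.
have n0 : 0 < n%:R :> R.
  rewrite ltr0n lt0n; apply: contraTN mt => /eqP ->.
  by rewrite mul0r -leNgt.
have e0 : 0 < (n%:R * val t - m%:R) / n%:R by rewrite divr_gt0// subr_gt0.
apply: (unit_itv_cvg_const e0) => s st.
have {}st : val s < val t := st.
rewrite gtr0_norm ?subr_gt0// ltr_pdivlMr// => es.
rewrite /step_fun (lt_le_trans st t1); congr y; apply: truncn_def.
by apply/andP; split; nra.
Qed.

Lemma step_fun_left_limit (t : unit_itv R) : exists l : 'rV[R]_d,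
  step_fun @ within [set s : unit_itv R | val s < val t] (nbhs t) --> l.
Proof.
have /andP[t0 t1] := unit_itvP t.
have [nt0|nt0] := ltP 0 (n%:R * val t); last first.
  exists (y 0); apply: (unit_itv_cvg_const (e := 1)) => // s st _.
  have {}st : val s < val t := st.
  have /andP[s0 _] := unit_itvP s.
  rewrite /step_fun (lt_le_trans st t1); congr y; apply: truncn_def.
  have n0 : 0 <= n%:R :> R by [].
  by apply/andP; split; nra.
have /andP[kle ltk] := truncn_itv (ltW nt0).
set k := Num.truncn (n%:R * val t) in kle ltk.
have [knt|] := ltP k%:R (n%:R * val t).
  by exists (y k); apply: step_fun_left; rewrite knt ltW.
move=> ntk; exists (y k.-1); apply: step_fun_left.
have k0 : (0 < k)%N by rewrite -(ltr_nat R); exact: lt_le_trans ntk.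
by rewrite prednK// ntk andbT (lt_le_trans _ kle)// ltr_nat prednK.
Qed.

Lemma step_fun_left1 (t : unit_itv R) : val t = 1 ->
  step_fun @ within [set s : unit_itv R | val s < val t] (nbhs t) --> step_fun t.
Proof.
move=> t1; have -> : step_fun t = y n.-1 by rewrite /step_fun t1 ltxx.
have [n0|n0] := posnP n; last first.
  by apply: step_fun_left; rewrite t1 mulr1 prednK// lexx ltr_nat prednK// leqnn.
apply: (unit_itv_cvg_const (e := 1)) => // s st _.
have {}st : val s < val t := st.
rewrite /step_fun n0 mul0r.
by rewrite truncn0 if_same.
Qed.

Definition step_path : D01 R d :=
  MkD01 step_fun_right step_fun_left_limit step_fun_left1.

End step_function.

Definition step_embedding (R : realType) (d n : nat) (T : Type)
    (Y : nat -> T -> 'rV[R]_d) (w : T) : D01 R d :=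
  step_path n (fun k => Y k w).

(* The X_n and X may live on different probability spaces. *)
Definition cvg_in_law (R : realType) (S : topologicalType)
    (dT : nat -> measure_display) (T : forall n, measurableType (dT n))
    (P : forall n, probability (T n) R) (Xn : forall n, T n -> S)
    (dT' : measure_display) (T' : measurableType dT')
    (Q : probability T' R) (X : T' -> S) : Prop :=
  forall G : S -> R, continuous G -> [bounded G x | x in [set: S]] ->
    'E_(P n)[G \o Xn n]%E @[n --> \oo] --> 'E_Q[G \o X]%E.

(* (R^d)^k is represented by the space of k x d matrices. *)
Definition cvg_fdd (R : realType) (d : nat) (I : set (unit_itv R))
    (dT : nat -> measure_display) (T : forall n, measurableType (dT n))
    (P : forall n, probability (T n) R) (Xn : forall n, T n -> D01 R d)
    (dT' : measure_display) (T' : measurableType dT')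
    (Q : probability T' R) (X : T' -> D01 R d) : Prop :=
  forall (k : nat) (t : 'I_k -> unit_itv R), (forall i, I (t i)) ->
    cvg_in_law P (fun n w => \matrix_(i < k) Xn n w (t i))
               Q (fun w => \matrix_(i < k) X w (t i)).

Section markov_chain.
Context {R : realType} {dE : measure_display} {E : measurableType dE}.
Variable K : R.-pker E ~> E.

Section chain.
Context {dT : measure_display} {T : measurableType dT} {P : probability T R}.
Variable Y : nat -> {RV P >-> E}.

Definition past (k : nat) : set (set T) :=
  <<s \bigcup_(i in `I_k.+1) preimage_set_system setT (Y i) measurable >>.

(* P(Y_(k+1) in A | Y_0, ..., Y_k) = K(Y_k, A) almost surely, for all k. *)
Definition is_markov_chain : Prop := forall k A B,
  measurable A -> past k B ->
  P (B `&` Y k.+1 @^-1` A) = (\int[P]_(w in B) K (Y k w) A)%E.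

End chain.

Fixpoint kernel_iter (j : nat) : R.-spker E ~> E :=
  if j is i.+1 then mkcomp_noparam (kernel_iter i) K
  else kdirac (@measurable_id _ E setT).

(* kernel_iter j x is the law of Y_j under P( . | Y_0 = x). *)
Lemma kernel_iterP (dT : measure_display) (T : measurableType dT)
    (P : probability T R) (Y : nat -> {RV P >-> E}) (x : E) :
  is_markov_chain Y ->
  (forall A, measurable A -> P (Y 0%N @^-1` A) = \d_x A) ->
  forall j A, measurable A -> P (Y j @^-1` A) = kernel_iter j x A.
Proof.
move=> YK Y0; elim => [|j IH] A mA; first exact: Y0.
have := YK j A setT mA; rewrite setTI => ->; last first.
  by rewrite -setC0; apply: sigma_algebraC; exact: sigma_algebra0.
have -> : kernel_iter j.+1 x A = (\int[kernel_iter j x]_y K y A)%E by [].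
rewrite [RHS](@eq_measure_integral _ _ _ setT (pushforward P (Y j)))/=; last first.
  by move=> B mB _; rewrite -IH.
rewrite ge0_integral_pushforward//=.
exact: measurable_kernel.
Qed.

End markov_chain.

(* Main.v *)
Require Import Defs.
From HB Require Import structures.
From mathcomp Require Import all_boot all_order all_algebra.
From mathcomp Require Import all_classical all_reals all_analysis.
From mathcomp Require Import ring lra measurable_realfun giry.

(** The proof trades weak convergence of random paths for convergence of
    finitely many of their values, and the price is a modulus of continuity
    that holds uniformly in [n] with high probability.

    Call a path slowly oscillating, with parameters [e] and [del], if [0,1]
    splits into intervals longer than [del] on each of which the path
    oscillates by at most [e].  Such a path is J1-close to the step path that
    samples it once in each interval (k/m, (k+1)/m), as soon as 2/m <= [del]
    ([slowly_oscillating_J1_ball]): a piecewise linear time change moves the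
    jumps of the step path onto the ends of the pieces.  Each path of D[0,1]
    is slowly oscillating for some [del] ([D01_slowly_oscillating]).

    Convergence in law need only be tested on bounded uniformly continuous
    functionals, because each bounded continuous functional is the increasing
    limit of its Lipschitz minorants ([cvg_in_law_uniformly_continuous]); this
    replaces relative compactness of laws and the identification of limit
    points.  For such a functional [G], the means of [G] at X^(n) and at X are
    compared through the sampled paths ([cvg_mean_uniformly_continuous]).
    The sample points come from the dense set, so the sampled means
    converge by the convergence of the finite-dimensional distributions.
    Sampling changes the mean at X little by dominated convergence, and it
    changes the means at X^(n) little, uniformly in large n, provided that
    X^(n) is slowly oscillating with the same [del] off an event of small
    probability ([slowly_oscillating_whp]).

    This last point is where the Markov property enters.  Let the exit times
    of the chain be the successive times at which it is farther than [eps] from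
    its position at the previous exit time.  If the chain stays in a ball, has
    fewer than N exits before time n, no two successive exits within [del] * n
    steps, and no increment above [eps] during the last [del] * n steps, then
    the intervals between exits show that the path is slowly oscillating
    ([step_path_slowly_oscillating]).  Containment bounds the
    probability of leaving the ball.  The assumption on the transition kernels
    bounds the probability of a large increment over a fixed number of steps,
    and Ottaviani's argument turns it into a bound on the probability of an
    exit within that number of steps ([sum_pr_exit_le]).  An exponential weight
    in time then shows that N exits before time n are unlikely when N is large,
    uniformly in n ([many_exits_le]), and for fixed N a small enough [del] makes
    a short gap among N exits unlikely ([pr_bad_event_le]). *)
Set Implicit Arguments.
Unset Strict Implicit.
Unset Printing Implicit Defensive.

Import Order.TTheory GRing.Theory Num.Theory.
Import numFieldNormedType.Exports.

Local Open Scope classical_set_scope.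
Local Open Scope ring_scope.

(** * Time changes of the unit interval *)
Section unit_interval.
Context {R : realType}.

Definition clamp01 (x : R) : R := Num.max 0 (Num.min 1 x).

Lemma clamp01_itv x : 0 <= clamp01 x <= 1.
Proof.
by rewrite /clamp01 le_max lexx/= ge_max ler01/= ge_min lexx.
Qed.

Lemma clamp01_id x : 0 <= x <= 1 -> clamp01 x = x.
Proof. by move=> /andP[x0 x1]; rewrite /clamp01 min_r// max_r. Qed.

Lemma clamp01_le0 x : x <= 0 -> clamp01 x = 0.
Proof. by move=> x0; rewrite /clamp01 min_r ?max_l// (le_trans x0). Qed.

Lemma clamp01_ge1 x : 1 <= x -> clamp01 x = 1.
Proof. by move=> x1; rewrite /clamp01 min_l// max_r. Qed.

Lemma continuous_clamp01 : continuous clamp01.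
Proof.
move=> x; apply: (@continuous_max R R (cst 0) (fun x => Num.min 1 x)).
  exact: cvg_cst.
by apply: (@continuous_min R R (cst 1) id); [exact: cvg_cst|].
Qed.

Definition ramp (x y t : R) : R := clamp01 ((t - x) / (y - x)).

Lemma ramp_itv (x y t : R) : 0 <= ramp x y t <= 1.
Proof. exact: clamp01_itv. Qed.

Lemma continuous_ramp (x y : R) : continuous (ramp x y).
Proof.
move=> t; apply: (@continuous_comp _ _ _ (fun t => (t - x) / (y - x)) clamp01).
  by apply: cvgM; [apply: cvgB; [exact: cvg_id|exact: cvg_cst]|exact: cvg_cst].
exact: continuous_clamp01.
Qed.

Section ramp_lt.
Variables (x y : R).
Hypothesis xy : x < y.

Let yx0 : 0 < y - x. Proof. by rewrite subr_gt0. Qed.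

Lemma ramp_le0 (t : R) : t <= x -> ramp x y t = 0.
Proof. by move=> tx; apply: clamp01_le0; rewrite pmulr_lle0 ?invr_gt0// subr_le0. Qed.

Lemma ramp_ge1 (t : R) : y <= t -> ramp x y t = 1.
Proof. by move=> yt; apply: clamp01_ge1; rewrite ler_pdivlMr// mul1r lerB. Qed.

Lemma rampE (t : R) : x <= t <= y -> ramp x y t = (t - x) / (y - x).
Proof.
move=> /andP[xt ty]; apply: clamp01_id.
by rewrite divr_ge0 ?subr_ge0 ?(ltW xy)//= ler_pdivrMr// mul1r lerD2r.
Qed.

Lemma ramp_lt1 (t : R) : x <= t -> t < y -> ramp x y t < 1.
Proof.
by move=> xt ty; rewrite rampE ?xt ?(ltW ty)// ltr_pdivrMr// mul1r ltrD2r.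
Qed.

Lemma ramp_mono (s t : R) : x <= s -> s < t -> t <= y -> ramp x y s < ramp x y t.
Proof.
move=> xs st ty; have sy := le_trans (ltW st) ty; have xt := le_trans xs (ltW st).
by rewrite !rampE ?xs ?xt// ltr_pM2r ?invr_gt0// ltrD2r.
Qed.

(** While [t] runs from [x] to [y], the interpolation runs from [a] to [b] and
    the identity from [x] to [y] at the same pace, so their difference is a convex
    combination of [a - x] and [b - y]. *)
Lemma ramp_interpolation_close (a b h t : R) : x <= t <= y ->
  `|a - x| <= h -> `|b - y| <= h -> `|a + (b - a) * ramp x y t - t| <= h.
Proof.
move=> xty ax yb; have /andP[c0 c1] := ramp_itv x y t.
have : t = x + ramp x y t * (y - x).
  by rewrite rampE// divfK ?gt_eqF//; ring.
move: (ramp x y t) c0 c1 => c c0 c1 ->.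
rewrite (_ : _ - _ = (1 - c) * (a - x) + c * (b - y)); last by ring.
rewrite (le_trans (ler_normD _ _))// !normrM (ger0_norm c0) ger0_norm ?subr_ge0//.
have -> : h = (1 - c) * h + c * h by ring.
by rewrite lerD// ler_wpM2l// subr_ge0.
Qed.

End ramp_lt.

Definition unit_proj (x : R) : unit_itv R :=
  SigSub (mem_set (clamp01_itv x : [set t : R | 0 <= t <= 1] (clamp01 x))).

Lemma val_unit_proj x : 0 <= x <= 1 -> val (unit_proj x) = x.
Proof. exact: clamp01_id. Qed.

Lemma continuous_to_unit_itv (T : topologicalType) (g : T -> unit_itv R) :
  continuous (fun x => val (g x)) -> continuous g.
Proof. by move=> cg; exact: continuous_comp_initial. Qed.

Lemma continuous_val_unit_itv : continuous (fun t : unit_itv R => val t).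
Proof. exact: (@initial_continuous (unit_itv R) R set_val). Qed.

Lemma homo_unit_itv (l : R -> R) x : l 0 = 0 -> l 1 = 1 ->
  (forall s t : R, 0 <= s -> s < t -> t <= 1 -> l s < l t) ->
  0 <= x <= 1 -> 0 <= l x <= 1.
Proof.
move=> l0 l1 lmono /andP[]; rewrite !le_eqVlt => /predU1P[<-|x0].
  by rewrite l0 eqxx ltr01 orbT.
move=> /predU1P[->|x1]; first by rewrite l1 eqxx ltr01 orbT.
have := lmono 0 x; rewrite l0 => -> //; last exact: ltW.
have := lmono x 1; rewrite l1 => -> //; last exact: ltW.
by rewrite !orbT.
Qed.

Lemma unit_proj_time_change (l : R -> R) : continuous l ->
  l 0 = 0 -> l 1 = 1 ->
  (forall s t : R, 0 <= s -> s < t -> t <= 1 -> l s < l t) ->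
  time_change (fun t : unit_itv R => unit_proj (l (val t))).
Proof.
move=> cl l0 l1 lmono.
have l01 (t : unit_itv R) : 0 <= l (val t) <= 1.
  exact: homo_unit_itv (unit_itvP t).
split.
  have linj : injective (fun t : unit_itv R => unit_proj (l (val t))).
    move=> s t /(congr1 val); rewrite !val_unit_proj// => lst.
    apply/val_inj; have := unit_itvP s; have := unit_itvP t => t01 s01.
    have [st|st|//] := ltgtP (val s) (val t).
      by have := lmono _ _ (proj1 (andP s01)) st (proj2 (andP t01)); rewrite lst ltxx.
    by have := lmono _ _ (proj1 (andP t01)) st (proj2 (andP s01)); rewrite lst ltxx.
  have /choice[k kP] : forall t : unit_itv R, exists s : unit_itv R,
      unit_proj (l (val s)) = t.
    move=> t; have [|||s] := @IVT R l 0 1 (val t).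
    - exact: ler01.
    - exact: continuous_subspaceT.
    - by rewrite l0 l1 min_l ?max_r ?ler01// unit_itvP.
    rewrite in_itv/= => s01 ls; exists (unit_proj s); apply/val_inj.
    by rewrite !val_unit_proj// ls unit_itvP.
  by exists k => // t; apply: linj; rewrite kP.
apply: continuous_to_unit_itv => t.
apply: (@continuous_comp _ _ _ (fun t : unit_itv R => l (val t)) clamp01).
  apply: (@continuous_comp _ _ _ (fun t : unit_itv R => val t) l).
    exact: continuous_val_unit_itv.
  exact: cl.
exact: continuous_clamp01.
Qed.

End unit_interval.

(** * Slowly oscillating paths are close to their samples *)
Section slow_oscillation.
Context {R : realType} {d : nat}.
Implicit Types e del a b : R.

(** The pieces [a, b[ are added from left to right, so that a time change
    adapted to the partition can be built by induction, one piece at a time. *)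
Inductive slow_partition (f : unit_itv R -> 'rV[R]_d) (e del : R) : R -> Prop :=
| slow_partition0 : slow_partition f e del 0
| slow_partitionS a b : slow_partition f e del a -> a + del < b ->
    (forall u v : unit_itv R, a <= val u < b -> a <= val v < b ->
      enorm (f u - f v) <= e) ->
    slow_partition f e del b.

(** The last piece is closed: a path of D[0,1] has no jump at 1, and the time
    changes constructed below fix 1. *)
Definition slowly_oscillating (f : unit_itv R -> 'rV[R]_d) (e del : R) :=
  exists a, [/\ slow_partition f e del a, a + del < 1 &
    forall u v : unit_itv R, a <= val u -> a <= val v -> enorm (f u - f v) <= e].

Lemma slow_partition_ge0 f e del a : 0 < del -> slow_partition f e del a -> 0 <= a.
Proof. by move=> del0; elim=> [|{}a b _ a0 ab _]; lra. Qed.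

Section time_change.
Variables (m : nat) (p : nat -> unit_itv R).
Hypothesis m0 : (0 < m)%N.
Hypothesis pm : forall k, (k < m)%N -> k%:R / m%:R < val (p k) < k.+1%:R / m%:R.

Let mR0 : 0 < m%:R :> R. Proof. by rewrite ltr0n. Qed.

(** The points [p i] lie in disjoint successive intervals of length 1/m, so the
    number [c] of those before [b] determines [b] up to 1/m. *)
Lemma sample_count (b : R) : 0 <= b <= 1 -> exists c : nat,
  [/\ (c <= m)%N, forall i, (i < m)%N -> (i < c)%N = (val (p i) < b),
      b - m%:R^-1 <= c%:R / m%:R & c%:R / m%:R <= b + m%:R^-1].
Proof.
move=> /andP[b0 b1].
have mb0 : 0 <= m%:R * b by rewrite mulr_ge0.
have /andP[kle ltk] := truncn_itv mb0.
set k := Num.truncn _ in kle ltk.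
have km : (k <= m)%N by rewrite -(ler_nat R) (le_trans kle)// ler_piMr.
have lo i : (i < m)%N -> (i < k)%N -> val (p i) < b.
  move=> im ik; have /andP[_ /lt_le_trans] := pm im; apply.
  rewrite ler_pdivrMr// [b * _]mulrC (le_trans _ kle)//.
  by rewrite ler_nat.
have hi i : (i < m)%N -> (k < i)%N -> b < val (p i).
  move=> im ik; have /andP[/(le_lt_trans _)+ _] := pm im; apply.
  rewrite ler_pdivlMr// [b * _]mulrC (le_trans (ltW ltk))//.
  by rewrite ler_nat.
have [/andP[km' pkb]|npk] := boolP ((k < m)%N && (val (p k) < b)).
- exists k.+1; split=> //.
  + move=> i im; rewrite ltnS leq_eqVlt.
    have [->|/eqP ik] := eqVneq i k; first by rewrite pkb.
    case: ltngtP ik => //= ik _; first by rewrite lo.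
    by apply/esym/negbTE; rewrite -leNgt ltW// hi.
  + by rewrite ler_pdivlMr// mulrBl mulVf ?gt_eqF// -natr1; lra.
  + by rewrite ler_pdivrMr// mulrDl mulVf ?gt_eqF// -natr1; lra.
- exists k; split=> //.
  + move=> i im; case: ltngtP => ik; first by rewrite lo.
      by apply/esym/negbTE; rewrite -leNgt ltW// hi.
    subst i; apply/esym/negbTE; move: npk; rewrite im/=; exact.
  + by rewrite ler_pdivlMr// mulrBl mulVf ?gt_eqF//; move: ltk; rewrite -natr1; lra.
  + by rewrite ler_pdivrMr// mulrDl mulVf ?gt_eqF//; lra.
Qed.

(** The time change [l] maps c/m to [b], where [c] counts the sample points
    before [b]; thus, for [t] in the steps belonging to a piece, [l t] lies in
    the same piece as the sample point that gives the step its value.  A new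
    piece [a, b[ is treated by adding to [l] a ramp of height [b - a]; the ramp
    has a positive length because the piece is longer than 2/m. *)
Lemma slow_partition_time_change f e del (b : R) :
  2 / m%:R <= del -> slow_partition f e del b -> b <= 1 ->
  exists (c : nat) (l : R -> R), [/\ [/\ (c <= m)%N,
      forall i, (i < m)%N -> (i < c)%N = (val (p i) < b),
      b - m%:R^-1 <= c%:R / m%:R & c%:R / m%:R <= b + m%:R^-1],
    continuous l, l 0 = 0, forall t : R, c%:R / m%:R <= t -> l t = b &
    [/\ forall s t : R, 0 <= s -> s < t -> t <= c%:R / m%:R -> l s < l t,
        forall t : R, 0 <= t <= c%:R / m%:R -> `|l t - t| <= m%:R^-1 &
        forall t : R, 0 <= t < c%:R / m%:R ->
          enorm (f (unit_proj (l t)) - f (p (Num.truncn (m%:R * t)))) <= e]].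
Proof.
move=> mdel; have im0 : 0 < m%:R^-1 :> R by rewrite invr_gt0.
have del0 : 0 < del by rewrite (lt_le_trans _ mdel)// divr_gt0.
elim=> [_|a {}b fa IH ab fab b1].
  exists 0%N, (cst 0); split => //.
  - by split; rewrite ?mul0r ?add0r// ?lerN ?oppr_le0 ?ltW// => i _;
      rewrite ltn0; apply/esym/negbTE; rewrite -leNgt; case/andP: (unit_itvP (p i)).
  - exact: cst_continuous.
  - split => [s t|t|t]; rewrite mul0r.
    + by move=> s0 st t0; lra.
    + move=> t0; have -> : t = 0 by lra.
      by rewrite subrr normr0 ltW.
    + by move=> t0; lra.
have a0 := slow_partition_ge0 del0 fa.
have ltab : a < b by rewrite (lt_trans _ ab)// ltrDl.
have b0 : 0 <= b by rewrite (le_trans a0)// ltW.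
have [ca [l [[cam cap calo cahi] cl l0 lc [lmono lid lf]]]] :=
  IH (le_trans (ltW ltab) b1).
have [|c [cm cp clo chi]] := @sample_count b; first by rewrite b0.
set x : R := ca%:R / m%:R in calo cahi lc lmono lid lf.
set y : R := c%:R / m%:R in clo chi *.
have x0 : 0 <= x by rewrite divr_ge0.
have xy : x < y.
  (* x and y are within 1/m of a and b, and b - a is more than 2/m *)
  rewrite (le_lt_trans cahi)// (lt_le_trans _ clo)// ltrBrDr -addrA.
  by rewrite (le_lt_trans _ ab)// lerD2l (le_trans _ mdel)// mulr2n mulrDl mul1r.
have ab0 : 0 <= b - a by rewrite subr_ge0 ltW.
have ax : `|a - x| <= m%:R^-1 by rewrite distrC ler_distl calo cahi.
have by_ : `|b - y| <= m%:R^-1 by rewrite distrC ler_distl clo chi.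
exists c, (fun t => l t + (b - a) * ramp x y t); split.
- by [].
- move=> t; apply: cvgD; first exact: cl.
  by apply: cvgM; [exact: cvg_cst|exact: continuous_ramp].
- by rewrite l0 ramp_le0// mulr0 addr0.
- by move=> t yt; rewrite ramp_ge1// lc ?(le_trans (ltW xy))//; ring.
- split.
  + move=> s t s0 st; rewrite -/y => ty.
    have [tx|xt] := leP t x.
      by rewrite !ramp_le0// ?ltrD2r ?lmono// (le_trans (ltW st)).
    have [sx|xs] := ltP s x; last first.
      rewrite !lc ?(ltW xt)// ltrD2l ltr_pM2l ?subr_gt0//.
      exact: ramp_mono.
    rewrite ramp_le0 ?(ltW sx)// mulr0 addr0 (lc t) ?(ltW xt)//.
    have ls : l s < a by rewrite -(lc x)// lmono.
    rewrite (lt_le_trans ls)// lerDl mulr_ge0//.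
    by have /andP[] := ramp_itv x y t.
  + move=> t; rewrite -/y => /andP[t0 ty].
    have [tx|xt] := leP t x; first by rewrite ramp_le0// mulr0 addr0 lid// t0.
    by rewrite lc ?(ltW xt)// ramp_interpolation_close// (ltW xt).
  + move=> t; rewrite -/y => /andP[t0 ty].
    have [tx|xt] := ltP t x.
      by rewrite ramp_le0 ?(ltW tx)// mulr0 addr0 lf// t0.
    rewrite (lc t)//.
    have /andP[c0 _] := ramp_itv x y t; have c1 := ramp_lt1 xy xt ty.
    have lo : a <= a + (b - a) * ramp x y t by rewrite lerDl mulr_ge0.
    have hi : a + (b - a) * ramp x y t < b.
      by rewrite -ltrBrDl gtr_pMr// subr_gt0.
    have mt0 : 0 <= m%:R * t by rewrite mulr_ge0.
    have kc : (Num.truncn (m%:R * t) < c)%N.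
      by rewrite truncn_lt_nat// mulrC -ltr_pdivlMr.
    have ck : (ca <= Num.truncn (m%:R * t))%N.
      by rewrite truncn_ge_nat// mulrC -ler_pdivrMr.
    have km := leq_trans kc cm.
    (* l t and the sample point with index floor (m t) both lie in [a, b[ *)
    apply: fab; last by rewrite -cp// kc andbT leNgt -cap// -leqNgt.
    rewrite val_unit_proj; first by rewrite lo.
    by rewrite (le_trans a0 lo) (le_trans (ltW hi)).
Qed.

(** The time change is the identity up to 1/m, and it carries the path to within
    [e] of the step path. *)
Lemma slowly_oscillating_J1_ball (f : D01 R d) e del r :
  slowly_oscillating f e del -> 2 / m%:R <= del -> e < r -> m%:R^-1 < r ->
  J1_ball f r (step_path m (fun k => f (p k))).
Proof.
move=> [a [fa a1 fa1]] mdel er mr.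
have im0 : 0 < m%:R^-1 :> R by rewrite invr_gt0.
have f1 : slow_partition f e del 1.
  apply: slow_partitionS fa a1 _ => u v /andP[au _] /andP[av _]; exact: fa1.
have [c [l [[cm cp clo chi] cl l0 lc]]] := slow_partition_time_change mdel f1 (lexx 1).
have cE : c = m.
  apply/eqP; rewrite eqn_leq cm/= -{1}(prednK m0) cp ?ltn_predL//.
  have /andP[_ /lt_le_trans] := pm (ltac:(by rewrite ltn_predL) : (m.-1 < m)%N).
  by apply; rewrite prednK// divff// gt_eqF.
have {clo chi} y1 : c%:R / m%:R = 1 :> R by rewrite cE divff ?gt_eqF.
rewrite y1 in lc *; move=> [lmono lid lf].
have l1 : l 1 = 1 by rewrite lc.
apply/J1_dist_ltP; exists (fun t => unit_proj (l (val t))), (Num.max e m%:R^-1).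
split=> [||t|t].
- exact: unit_proj_time_change.
- by rewrite gt_max er.
- rewrite le_max; apply/orP; left.
  have /andP[t0 t1] := unit_itvP t.
  rewrite /step_path/= /step_fun.
  have [t1'|t1'] := ltP (val t) 1; first by rewrite lf// t0.
  have {}t1 : val t = 1 by apply/eqP; rewrite eq_le t1.
  have m1 : m.-1%:R = m%:R - 1 :> R by rewrite -{2}(prednK m0) -natr1; ring.
  apply: fa1.
    rewrite val_unit_proj t1 l1 ?ler01 ?lexx//; lra.
  have /andP[+ _] := pm (ltac:(by rewrite ltn_predL) : (m.-1 < m)%N).
  by rewrite m1 mulrBl divff ?gt_eqF//; lra.
- have t01 := unit_itvP t.
  rewrite le_max; apply/orP; right; rewrite val_unit_proj ?lid//.
  exact: homo_unit_itv (unit_itvP t).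
Qed.

End time_change.
End slow_oscillation.

(** * Every path of D[0,1] is slowly oscillating *)
Lemma coord_le_norm (R : realType) (k d : nat) (x : 'M[R]_(k, d)) i j :
  `|x i j| <= `|x|.
Proof.
rewrite [leRHS]/Num.Def.normr/= mx_normrE; apply/bigmax_geP; right => /=.
by exists (i, j).
Qed.

Lemma enorm_le_norm (R : realType) (d : nat) (x : 'rV[R]_d) :
  enorm x <= Num.sqrt d%:R * `|x|.
Proof.
rewrite -[X in _ * X]normr_id -sqrtr_sqr -sqrtrM ?ler0n//; apply: ler_wsqrtr.
rewrite mulr_natl; set r := `|x| ^+ 2.
have -> : r *+ d = \sum_(i < d) r by rewrite sumr_const card_ord.
apply: ler_sum => i _.
rewrite -[_ ^+ 2]real_normK ?num_real// lerXn2r ?nnegrE//.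
exact: coord_le_norm.
Qed.

Lemma cvg_enorm (R : realType) (d : nat) (U : Type) (F : set_system U)
    (FF : Filter F) (g : U -> 'rV[R]_d) (l : 'rV[R]_d) (e : R) :
  0 < e -> g @ F --> l -> \forall u \near F, enorm (g u - l) < e.
Proof.
move=> e0 /cvgrPdist_lt gl.
have s0 : 0 < Num.sqrt d%:R + 1 :> R by rewrite ltr_wpDl// sqrtr_ge0.
have /gl : 0 < e / (Num.sqrt d%:R + 1) by rewrite divr_gt0.
apply: filterS => u; rewrite distrC ltr_pdivlMr// => ul.
apply: le_lt_trans ul; rewrite (le_trans (enorm_le_norm _))// mulrC.
by rewrite ler_wpM2l// ler_wpDr.
Qed.

Lemma nbhs_unit_itv (R : realType) (t : unit_itv R) (A : set (unit_itv R)) :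
  nbhs t A -> exists2 r : R, 0 < r & forall s, `|val s - val t| < r -> A s.
Proof.
move=> /nbhs_ballP[r /= r0 rA]; exists r => // s st; apply: rA.
by have : ball (val t : R) r (val s) by rewrite -ball_normE/= distrC.
Qed.

Section every_path_oscillates_slowly.
Context {R : realType} {d : nat}.
Implicit Types (f : D01 R d) (e del a b : R).

(** Allowing [f u = l] in the place of [A u] includes the point [t] itself on
    the sides from which the path is continuous at [t]. *)
Lemma one_sided_osc f (t : unit_itv R) (A : set (unit_itv R)) l e :
  0 < e -> f @ within A (nbhs t) --> l -> exists2 r : R, 0 < r &
    forall u v, A u \/ f u = l -> A v \/ f v = l ->
    `|val u - val t| < r -> `|val v - val t| < r -> enorm (f u - f v) <= e.
Proof.
move=> e0 fl; have e2 : 0 < e / 2 by rewrite divr_gt0.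
have [r r0 rA] := nbhs_unit_itv (cvg_enorm _ e2 fl).
have near_l u : A u \/ f u = l -> `|val u - val t| < r -> enorm (f u - l) <= e / 2.
  by move=> [Au ut|-> _]; [exact/ltW/rA|rewrite subrr enorm0 ltW].
exists r => // u v Au Av ut vt.
rewrite (_ : f u - f v = (f u - l) + - (f v - l)); last by rewrite opprB addrA subrK.
by rewrite (le_trans (ler_enormD _ _))// enormN (splitr e) lerD// near_l.
Qed.

Lemma slow_partition_le f e del del' a :
  del' <= del -> slow_partition f e del a -> slow_partition f e del' a.
Proof.
move=> dd; elim=> [|{}a b _ IH ab fab]; first exact: slow_partition0.
by apply: slow_partitionS IH _ fab; rewrite (le_lt_trans _ ab)// lerD2l.
Qed.

(** One more piece of any length can be added, at the cost of a smaller [del]. *)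
Lemma slow_partition_extend f e del a b :
  0 < del -> slow_partition f e del a -> a < b ->
  (forall u v : unit_itv R, a <= val u < b -> a <= val v < b ->
      enorm (f u - f v) <= e) ->
  exists2 del' : R, 0 < del' & slow_partition f e del' b.
Proof.
move=> del0 fa ab fab; exists (Num.min del ((b - a) / 2)).
  by rewrite lt_min del0 divr_gt0// subr_gt0.
apply: slow_partitionS fab; first by apply: slow_partition_le fa; rewrite ge_min lexx.
rewrite -ltrBrDl gt_min; apply/orP; right.
by rewrite ltr_pdivrMr// ltr_pMr ?subr_gt0// ltr1n.
Qed.

(** Let [sup S] be the supremum of the points reached by partitions.  The left
    limit there gives a last piece up to [sup S], so the supremum is attained;
    if it were less than 1, right continuity would add a piece beyond it. *)
Lemma slow_partition1 f e : 0 < e ->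
  exists2 del : R, 0 < del & slow_partition f e del 1.
Proof.
move=> e0.
pose S := [set t : R | t <= 1 /\ exists2 del : R, 0 < del & slow_partition f e del t].
have S0 : S 0 by split => //; exists 1 => //; exact: slow_partition0.
have supS : has_sup S by split; [exists 0|exists 1 => t []].
have T1 : sup S <= 1 by apply: ge_sup; [exists 0|move=> t []].
have T0 : 0 <= sup S by apply: ub_le_sup => //; case: supS.
pose t : unit_itv R := unit_proj (sup S).
have tE : val t = sup S by rewrite val_unit_proj// T0.
have ST : S (sup S).
  have [l fl] := D01_left_limit f t.
  have [r r0 fr] := one_sided_osc e0 fl.
  have [a [a1 [del del0 fa]] ra] := sup_adherent r0 supS.
  have Sa : S a by split => //; exists del.
  split => //; have := ub_le_sup (proj2 supS) Sa.
  rewrite le_eqVlt => /predU1P[<-|aT]; first by exists del.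
  have [u v /andP[au uT] /andP[av vT]|] := slow_partition_extend del0 fa aT.
    have lt_t (w : unit_itv R) : val w < sup S -> [set s | val s < val t] w.
      by rewrite -tE.
    have inr (w : unit_itv R) : a <= val w -> val w < sup S -> `|val w - val t| < r.
      by move=> aw wT; rewrite tE ltr0_norm ?subr_lt0// opprB; lra.
    by apply: fr; [left; exact: lt_t|left; exact: lt_t|exact: inr|exact: inr].
  by move=> del' del'0 fT; exists del'.
have [T1'|] := ltP (sup S) 1; last first.
  by move=> T1'; case: ST => _; rewrite (@le_anti _ _ (sup S) 1)// T1.
have [r r0 fr] := one_sided_osc e0 (@D01_right_continuous _ _ f t).
case: ST => _ [del del0 fT].
pose b := Num.min 1 (sup S + r / 2).
have r2 : 0 < r / 2 by rewrite divr_gt0.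
have Tb : sup S < b by rewrite lt_min T1' ltrDl.
have bT : b <= sup S + r / 2 by rewrite ge_min lexx orbT.
have [u v /andP[Tu ub] /andP[Tv vb]|del' del'0 fb] := slow_partition_extend del0 fT Tb.
  have inr (w : unit_itv R) : sup S <= val w -> val w < b -> `|val w - val t| < r.
    by move=> aw wT; rewrite tE ger0_norm ?subr_ge0//; lra.
  have right (w : unit_itv R) : sup S <= val w -> val t < val w \/ f w = f t.
    rewrite tE le_eqVlt => /predU1P[Tw|]; last by left.
    by right; congr (f _); apply/val_inj; rewrite tE.
  by apply: fr; [exact: right|exact: right|exact: inr|exact: inr].
have : S b by split; [rewrite ge_min lexx|exists del'].
by move/(ub_le_sup (proj2 supS)); rewrite leNgt Tb.
Qed.

(** The last piece of a partition of [0, 1[ may be closed at 1 without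
    increasing the oscillation, by left continuity at 1. *)
Lemma D01_slowly_oscillating f e : 0 < e ->
  exists2 del : R, 0 < del & slowly_oscillating f e del.
Proof.
move=> e0; have [del del0 f1] := slow_partition1 f e0.
exists del => //; move E : (1 : R) f1 => b f1.
case: f1 E => [|{}a {}b fa ab fab b1]; first by move/eqP; rewrite oner_eq0.
subst b; exists a; split => //.
have closure1 u (v : unit_itv R) : a <= val u < 1 -> val v = 1 -> enorm (f u - f v) <= e.
  move=> au v1; apply/ler_addgt0Pr => eta eta0.
  have [r r0 fr] := one_sided_osc eta0 (@D01_left_continuous_at1 _ _ f v v1).
  have m0 : 0 < Num.min (1 - a) r by rewrite lt_min r0 andbT subr_gt0; lra.
  (* a point of the last piece that is close enough to 1 *)
  pose s := 1 - Num.min (1 - a) r / 2.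
  have mr : Num.min (1 - a) r <= r by rewrite ge_min lexx orbT.
  have ma : Num.min (1 - a) r <= 1 - a by rewrite ge_min lexx.
  have a0 := slow_partition_ge0 del0 fa.
  have sE : val (unit_proj s) = s by rewrite val_unit_proj// /s; lra.
  rewrite (_ : f u - f v = (f u - f (unit_proj s)) + (f (unit_proj s) - f v)); last first.
    by rewrite addrA subrK.
  rewrite (le_trans (ler_enormD _ _))// lerD//.
    by apply: fab => //; rewrite sE /s; lra.
  apply: fr; [by left; change (val (unit_proj s) < val v); rewrite v1 sE /s; lra|by right| |by rewrite subrr normr0].
  by rewrite sE v1 /s addrAC subrr sub0r normrN ger0_norm; lra.
move=> u v au av; have /andP[_ u1] := unit_itvP u; have /andP[_ v1] := unit_itvP v.
move: u1 v1; rewrite (le_eqVlt (val u)) (le_eqVlt (val v)).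
move=> /predU1P[u1|u1] /predU1P[v1|v1].
- rewrite (_ : u = v) ?subrr ?enorm0; first exact: ltW.
  by apply/val_inj; rewrite u1.
- by rewrite -enormN opprB closure1// av.
- by rewrite closure1// au.
- by rewrite fab// ?au ?av.
Qed.

End every_path_oscillates_slowly.

(** * Means of bounded functions *)
Section bounded_means.
Context {R : realType} {dT : measure_display} {T : measurableType dT}.
Variable P : probability T R.
Implicit Types (f g : T -> R) (C a : R).

Lemma bounded_integrable f C : measurable_fun setT f ->
  (forall x, `|f x| <= C) -> P.-integrable setT (EFin \o f).
Proof.
move=> mf fC; apply: (@le_integrable _ _ _ P _ measurableT _ (EFin \o cst C)) => //.
- exact/measurable_EFinP.
- by move=> x _ /=; rewrite lee_fin (le_trans (fC x))// ler_norm.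
- exact: finite_measure_integrable_cst.
Qed.

Lemma expectation_bounded f C : measurable_fun setT f ->
  (forall x, `|f x| <= C) -> 'E_P[f]%E = (\int[P]_x f x)%:E.
Proof.
move=> mf fC; rewrite unlock /Rintegral fineK//.
exact/integrable_fin_num/(bounded_integrable mf fC).
Qed.

Lemma dist_mean_le f g C a (A : set T) :
  measurable_fun setT f -> measurable_fun setT g -> measurable A ->
  (forall x, `|f x| <= C) -> (forall x, `|g x| <= C) ->
  (forall x, ~ A x -> `|f x - g x| <= a) -> 0 <= a ->
  `|\int[P]_x f x - \int[P]_x g x| <= a + 2 * C * fine (P A).
Proof.
move=> mf mg mA fC gC fga a0.
have If := bounded_integrable mf fC; have Ig := bounded_integrable mg gC.
have mfg : measurable_fun setT (fun x => f x - g x) by exact: measurable_funB.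
have fgC x : `|f x - g x| <= 2 * C.
  by rewrite (le_trans (ler_normB _ _))// mulr2n mulrDl mul1r lerD.
have Ifg := bounded_integrable mfg fgC.
rewrite -RintegralB//; apply: (le_trans (le_normr_Rintegral _ _)) => //.
have mh : measurable_fun setT (fun x => a + 2 * C * \1_A x).
  apply: measurable_funD => //; apply: measurable_funM => //.
have hB x : `|a + 2 * C * \1_A x| <= a + `|2 * C|.
  rewrite (le_trans (ler_normD _ _))// (ger0_norm a0) lerD2l normrM.
  by rewrite indicE; case: (_ \in _); rewrite ?normr1 ?mulr1 ?normr0 ?mulr0.
have -> : a + 2 * C * fine (P A) = \int[P]_x (a + 2 * C * \1_A x).
  have mi : measurable_fun setT (\1_A : T -> R) by exact: measurable_indic.
  have iB x : `|\1_A x : R| <= 1.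
    by rewrite indicE; case: (_ \in _); rewrite ?normr1 ?normr0 ?ler01.
  have Ii := bounded_integrable mi iB.
  rewrite RintegralD//=; last 2 first.
  - exact: finite_measure_integrable_cst.
  - apply: (@bounded_integrable _ (`|2 * C|)); first exact: measurable_funM.
    by move=> x; rewrite normrM ler_piMr.
  rewrite Rintegral_cst//= (@probability_setT _ _ _ P) mulr1 RintegralZl//.
  by rewrite [in RHS]/Rintegral integral_indic// setIT.
apply: le_Rintegral => //.
- apply: (@bounded_integrable _ (2 * C)); first exact: measurableT_comp.
  by move=> x; rewrite normr_id.
- exact: bounded_integrable mh hB.
- move=> x _; rewrite indicE.
  have [_|] := boolP (x \in A); first by rewrite mulr1 ler_wpDl.
  by rewrite notin_setE mulr0 addr0; exact: fga.
Qed.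

Lemma le_mean f g C : measurable_fun setT f -> measurable_fun setT g ->
  (forall x, `|f x| <= C) -> (forall x, `|g x| <= C) ->
  (forall x, f x <= g x) -> \int[P]_x f x <= \int[P]_x g x.
Proof.
move=> mf mg fC gC fg; apply: le_Rintegral => //.
- exact: bounded_integrable mf fC.
- exact: bounded_integrable mg gC.
Qed.

Lemma cvg_mean (f_ : nat -> T -> R) f C : (forall n, measurable_fun setT (f_ n)) ->
  measurable_fun setT f -> (forall n x, `|f_ n x| <= C) ->
  (forall x, f_ n x @[n --> \oo] --> f x) ->
  \int[P]_x f_ n x @[n --> \oo] --> \int[P]_x f x.
Proof.
move=> mf_ mf f_C f_f.
have [] := @dominated_convergence _ _ _ P setT measurableT
  (fun n => EFin \o f_ n) (EFin \o f) (cst C%:E).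
- by move=> n; exact/measurable_EFinP.
- exact/measurable_EFinP.
- by apply: aeW => x _; apply: cvg_EFin; [exact: nearW|exact: f_f].
- exact: finite_measure_integrable_cst.
- by apply: aeW => x n _ /=; rewrite lee_fin.
move=> If _ cf; apply: fine_cvg; rewrite /Rintegral fineK//.
exact: integrable_fin_num If.
Qed.

End bounded_means.

(** * Convergence in law from uniformly continuous functionals *)
Section uniformly_continuous_minorants.
Context {R : realType} {S : pseudoMetricType R}.
Implicit Types (G : S -> R) (x y : S).

Definition uniformly_continuous G := forall e : R, 0 < e ->
  exists2 r : R, 0 < r & forall x y, ball x r y -> `|G x - G y| <= e.

(** The pseudometric underlying the balls, truncated at 1 so that the infimum is
    taken over a nonempty set. *)
Definition dist1 x y : R := inf ([set r : R | 0 < r /\ ball x r y] `|` [set 1]).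

Lemma dist1_inf x y : has_inf ([set r : R | 0 < r /\ ball x r y] `|` [set 1]).
Proof.
split; first by exists 1; right.
by exists 0 => r [[/ltW]//|->]; exact: ler01.
Qed.

Lemma dist1_ge0 x y : 0 <= dist1 x y.
Proof. by apply: lb_le_inf => [|r [[/ltW]//|->]]; [exists 1; right|exact: ler01]. Qed.

Lemma dist1_le x y r : 0 < r -> ball x r y -> dist1 x y <= r.
Proof. by move=> r0 xy; apply: ge_inf; [case: (dist1_inf x y)|left]. Qed.

Lemma dist1_ball x y r : r <= 1 -> dist1 x y < r -> ball x r y.
Proof.
move=> r1 /(inf_lt (proj1 (dist1_inf x y)))[s [[s0 xy] sr|->]].
  exact: le_ball (ltW sr) _ xy.
by rewrite ltNge r1.
Qed.

Lemma dist1_triangle x y z r : 0 < r -> ball x r y -> dist1 x z <= r + dist1 y z.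
Proof.
move=> r0 xy; rewrite -lerBlDl; apply: lb_le_inf; first by exists 1; right.
move=> s [[s0 yz]|->]; rewrite lerBlDl.
  by apply: dist1_le; [exact: addr_gt0|exact: ball_triangle xy yz].
by apply: (@le_trans _ _ 1); [apply: ge_inf; [case: (dist1_inf x z)|right]|rewrite ler_wpDl// ltW].
Qed.

(** The Pasch-Hausdorff envelope: the largest minorant of [G] that is Lipschitz
    with constant [k] for [dist1]. *)
Definition lower_envelope G (k : nat) x : R :=
  inf [set G y + k%:R * dist1 x y | y in [set: S]].

Variables (G : S -> R) (C : R).
Hypothesis GC : forall x, `|G x| <= C.

Let lb_G k x y : - C <= G y + k%:R * dist1 x y.
Proof.
have := GC y; rewrite ler_norml => /andP[Cy _].
by rewrite (le_trans Cy)// lerDl mulr_ge0// dist1_ge0.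
Qed.

Let env_inf k x : has_inf [set G y + k%:R * dist1 x y | y in [set: S]].
Proof.
split; first by exists (G x + k%:R * dist1 x x); exists x.
by exists (- C) => _ [y _ <-].
Qed.

Lemma lower_envelope_le k x : lower_envelope G k x <= G x.
Proof.
apply/ler_addgt0Pr => e e0.
have k0 : 0 < k%:R + 1 :> R by rewrite ltr_wpDl.
apply: (@le_trans _ _ (G x + k%:R * dist1 x x)).
  by apply: ge_inf; [case: (env_inf k x)|exists x].
rewrite lerD2l (@le_trans _ _ (k%:R * (e / (k%:R + 1))))//.
  rewrite ler_wpM2l// dist1_le ?divr_gt0//; apply: ballxx; exact: divr_gt0.
by rewrite mulrCA ler_piMr ?ltW// ltr_pdivrMr// mul1r ltrDl.
Qed.

Lemma lower_envelope_bounded k x : `|lower_envelope G k x| <= C.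
Proof.
have := GC x; rewrite !ler_norml => /andP[_ xC]; apply/andP; split.
  by apply: lb_le_inf => [|_ [y _ <-]]; [case: (env_inf k x)|exact: lb_G].
exact: le_trans (lower_envelope_le k x) xC.
Qed.

Lemma lower_envelope_uniformly_continuous k :
  uniformly_continuous (lower_envelope G k).
Proof.
move=> e e0; have k0 : 0 < k%:R + 1 :> R by rewrite ltr_wpDl.
exists (e / (k%:R + 1)); first exact: divr_gt0.
have r0 : 0 < e / (k%:R + 1) by exact: divr_gt0.
have half x y : ball x (e / (k%:R + 1)) y ->
    lower_envelope G k x - lower_envelope G k y <= e.
  move=> xy; rewrite lerBlDr -lerBlDl.
  apply: lb_le_inf; first by case: (env_inf k y).
  move=> _ [z _ <-]; rewrite lerBlDl.
  apply: (@le_trans _ _ (G z + k%:R * dist1 x z)).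
    by apply: ge_inf; [case: (env_inf k x)|exists z].
  rewrite addrCA lerD2l.
  apply: (@le_trans _ _ (k%:R * (e / (k%:R + 1) + dist1 y z))).
    by rewrite ler_wpM2l// dist1_triangle.
  rewrite mulrDr lerD2r mulrCA ler_piMr ?ltW// ltr_pdivrMr// mul1r ltrDl.
  exact: ltr01.
move=> x y xy; rewrite ler_norml half// andbT lerNl opprB.
by apply: half; exact: ball_sym.
Qed.

(** When [k] is large, a point [y] at distance at least [s] from [x] pays a
    penalty [k * s >= 2 * C], so only points near [x], where [G] is close to
    [G x], can bring the infimum below [G x]. *)
Lemma lower_envelope_cvg x : continuous G ->
  lower_envelope G k x @[k --> \oo] --> G x.
Proof.
move=> cG; apply/cvgrPdist_le => e e0.
have : nbhs x [set y | `|G x - G y| < e].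
  have /cvgrPdist_lt/(_ _ e0) := cG x; exact.
move=> /nbhs_ballP[r /= r0 rG].
pose s := Num.min r 1.
have s0 : 0 < s by rewrite lt_min r0 ltr01.
exists (Num.truncn (2 * C / s)).+1 => // k /= Ck.
have {}Ck : 2 * C <= k%:R * s.
  rewrite -ler_pdivrMr// (le_trans (ltW (truncnS_gt _)))// ler_nat//.
rewrite ger0_norm ?subr_ge0 ?lower_envelope_le// lerBlDr -lerBlDl.
apply: lb_le_inf; first by case: (env_inf k x).
move=> _ [y _ <-]; rewrite lerBlDl.
have [xy|xy] := ltP (dist1 x y) s.
  have : ball x r y.
    by apply: le_ball (dist1_ball _ xy); rewrite ge_min lexx ?orbT.
  move=> /rG /=; rewrite ltr_norml => /andP[_ Gxy].
  have : 0 <= k%:R * dist1 x y by rewrite mulr_ge0// dist1_ge0.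
  lra.
have : k%:R * s <= k%:R * dist1 x y by rewrite ler_wpM2l.
have := GC x; have := GC y; rewrite !ler_norml => /andP[? ?] /andP[? ?].
lra.
Qed.

End uniformly_continuous_minorants.

Lemma uniformly_continuous_continuous (R : realType) (S : pseudoMetricType R)
  (G : S -> R) : uniformly_continuous G -> continuous G.
Proof.
move=> uG x; apply/cvgrPdist_le => e e0; have [r r0 rG] := uG _ e0.
by apply/nbhs_ballP; exists r => // y /=; exact: rG.
Qed.

Section portmanteau.
Context {R : realType} {S : pseudoMetricType R}.
Context {dT : nat -> measure_display} {T : forall n, measurableType (dT n)}.
Variables (P : forall n, probability (T n) R) (Xn : forall n, T n -> S).
Context {dT' : measure_display} {T' : measurableType dT'}.
Variables (Q : probability T' R) (X : T' -> S).
Hypothesis mXn : forall n (G : S -> R), continuous G ->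
  measurable_fun setT (G \o @Xn n).
Hypothesis mX : forall G : S -> R, continuous G -> measurable_fun setT (G \o X).
Hypothesis cvg_uc : forall (G : S -> R) (C : R), uniformly_continuous G ->
  (forall x, `|G x| <= C) ->
  \int[P n]_w G (Xn w) @[n --> \oo] --> \int[Q]_w G (X w).

(** The means of an envelope converge, the envelope lies below [G], and its mean
    under the limit law is close to that of [G] by dominated convergence. *)
Lemma eventually_mean_ge (G : S -> R) (C e : R) : continuous G ->
  (forall x, `|G x| <= C) -> 0 < e ->
  \forall n \near \oo, \int[Q]_w G (X w) - e <= \int[P n]_w G (Xn w).
Proof.
move=> cG GC e0; have e2 : 0 < e / 2 by rewrite divr_gt0.
have uG k := lower_envelope_uniformly_continuous GC k.
have cE k := uniformly_continuous_continuous (uG k).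
have bE := lower_envelope_bounded GC.
have /cvgrPdist_le/(_ _ e2)[k _ /(_ k (leqnn k)) kG] :
    \int[Q]_w lower_envelope G k (X w) @[k --> \oo] --> \int[Q]_w G (X w).
  apply: (@cvg_mean _ _ _ Q _ _ C).
  - by move=> k; exact: mX (cE k).
  - exact: mX cG.
  - by move=> k w; exact: bE.
  - by move=> w; exact: lower_envelope_cvg.
have /cvgrPdist_le/(_ _ e2) := cvg_uc (uG k) (bE k).
apply: filterS => n nG.
have le : \int[P n]_w lower_envelope G k (Xn w) <= \int[P n]_w G (Xn w).
  apply: (@le_mean _ _ _ (P n) _ _ C).
  - exact: mXn (cE k).
  - exact: mXn cG.
  - by move=> w; exact: bE.
  - by move=> w; exact: GC.
  - by move=> w; exact: lower_envelope_le GC k _.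
move: kG nG; rewrite /= !ler_norml => /andP[_ kG] /andP[_ nG].
lra.
Qed.

(** The lower bound for [G] and the one for [- G] together give convergence. *)
Lemma cvg_in_law_uniformly_continuous : cvg_in_law P Xn Q X.
Proof.
move=> G cG bG.
have [C GC] : exists C : R, forall x, `|G x| <= C.
  have [C [_ GC]] := bG; exists (C + 1) => x; apply: (GC (C + 1)) => //.
  by rewrite ltrDl.
have NGC x : `|(- G x)| <= C by rewrite normrN.
have cNG : continuous (fun x => - G x) by move=> x; apply: cvgN; exact: cG.
have bX w : `|(G \o X) w| <= C by exact: GC.
have bXn n w : `|(G \o @Xn n) w| <= C by exact: GC.
have mGX : measurable_fun setT (G \o X) by exact: mX.
have mGXn n : measurable_fun setT (G \o @Xn n) by exact: mXn.
rewrite (expectation_bounded _ mGX bX).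
under eq_fun do rewrite (expectation_bounded _ (mGXn _) (bXn _)).
apply: cvg_EFin; first exact: nearW.
apply/cvgrPdist_le => /= e e0.
near=> n.
have lo : \int[Q]_w G (X w) - e <= \int[P n]_w G (Xn w).
  by near: n; exact: eventually_mean_ge GC e0.
have : \int[Q]_w (- G (X w)) - e <= \int[P n]_w (- G (Xn w)).
  by near: n; exact: (eventually_mean_ge cNG NGC e0).
have opp (d : measure_display) (U : measurableType d) (mu : probability U R)
    (f : U -> R) : measurable_fun setT f -> (forall w, `|f w| <= C) ->
    \int[mu]_w (- f w) = - \int[mu]_w f w.
  move=> mf fC; rewrite -[RHS]mulN1r -RintegralZl//.
    by apply: eq_Rintegral => w _; rewrite mulN1r.
  exact: bounded_integrable mf fC.
rewrite (opp _ _ _ _ mGX bX) (opp _ _ _ _ (mGXn n) (bXn n)).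
rewrite /= in lo *; move: lo; set u := \int[Q]_w _; set v := \int[_]_w _.
by move=> lo hi; rewrite ler_norml; apply/andP; split; lra.
Unshelve. all: by end_near. Qed.

End portmanteau.

(** * Measurability of functions of random paths *)
Lemma continuous_borel_measurable (R : realType) (S : ptopologicalType)
    (dT : measure_display) (T : measurableType dT) (X : T -> borel S) (G : S -> R) :
  measurable_fun setT X -> continuous G -> measurable_fun setT (G \o X).
Proof.
move=> mX cG; apply: (measurability _ (RGenOInfty.measurableE R)).
move=> _ [_ [x ->] <-].
have oGx : open (G @^-1` `]x, +oo[%classic).
  apply: open_comp => [s _|]; first exact: cG.
  rewrite (_ : `]x, +oo[%classic = [set y | y > x]); first exact: open_gt.
  by apply/seteqP; split => y /=; rewrite in_itv/= andbT.
have mGx : measurable (G @^-1` `]x, +oo[%classic : set (borel S)).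
  exact: sub_sigma_algebra.
exact: (mX measurableT _ mGx).
Qed.

Section discretisation.
Context {R : realType} {k d : nat} {dT : measure_display} {T : measurableType dT}.

(** The lattice cell of side [rho] that contains [x]. *)
Definition floor_mx (rho : R) (x : 'M[R]_(k, d)) : 'M[int]_(k, d) :=
  \matrix_(i, j) Num.floor (x i j / rho).

Lemma floor_mx_dist rho (x : 'M[R]_(k, d)) i j : 0 < rho ->
  `|x i j - rho * (floor_mx rho x i j)%:~R| <= rho.
Proof.
move=> rho0; have /andP[] := floor_itv (x i j / rho).
rewrite mxE intrD => lo hi.
have xE : x i j = rho * (x i j / rho) by rewrite mulrC divfK ?gt_eqF.
rewrite {1}xE -mulrBr normrM gtr0_norm// ler_piMr ?ltW//.
by rewrite ger0_norm ?subr_ge0//; lra.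
Qed.

Lemma floor_mx_norm rho (x : 'M[R]_(k, d)) : 0 < rho ->
  `|x - \matrix_(i, j) (rho * (floor_mx rho x i j)%:~R)| <= rho.
Proof.
move=> rho0.
rewrite [leLHS]/Num.Def.normr/= mx_normrE; apply/bigmax_leP; split; first exact: ltW.
by move=> [i j] _ /=; have := floor_mx_dist x i j rho0; rewrite !mxE.
Qed.

Lemma measurable_floor_mx rho (f : T -> 'M[R]_(k, d)) z : 0 < rho ->
  (forall i j, measurable_fun setT (fun w => f w i j)) ->
  measurable [set w | floor_mx rho (f w) = z].
Proof.
move=> rho0 mf.
have -> : [set w | floor_mx rho (f w) = z] =
    \bigcap_(ij in [set: 'I_k * 'I_d]) [set w |
      (rho * (z ij.1 ij.2)%:~R <= f w ij.1 ij.2) /\ (f w ij.1 ij.2 < rho * (z ij.1 ij.2 + 1)%:~R)].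
  have E w i j : (Num.floor (f w i j / rho) == z i j) =
      (rho * (z i j)%:~R <= f w i j) && (f w i j < rho * (z i j + 1)%:~R).
    by rewrite floor_eq ler_pdivlMr// ltr_pdivrMr// ![rho * _]mulrC.
  apply/seteqP; split => w /=.
    by move=> wz [i j] _ /=; apply/andP; rewrite -E -wz mxE.
  move=> h; apply/matrixP => i j; rewrite mxE; apply/eqP; rewrite E.
  by apply/andP; exact: (h (i, j)).
apply: fin_bigcap_measurable => // -[i j] _ /=.
rewrite [X in measurable X](_ : _ = (fun w => f w i j) @^-1`
  `[rho * (z i j)%:~R, rho * (z i j + 1)%:~R[%classic); last first.
  by apply/seteqP; split => w /=; rewrite in_itv/= => /andP.
by rewrite -[X in measurable X]setTI; apply: mf => //; exact: measurable_itv.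
Qed.

Lemma measurable_through_countable (I : countType) (g : T -> I)
    (dU : measure_display) (U : measurableType dU) (h : I -> U) :
  (forall i, measurable [set w | g w = i]) -> measurable_fun setT (h \o g).
Proof.
move=> mg _ B mB; rewrite setTI.
have -> : (h \o g) @^-1` B = \bigcup_n
    (if unpickle n is Some i then if h i \in B then [set w | g w = i] else set0 else set0).
  apply/seteqP; split => w /=.
    by move=> Bw; exists (pickle (g w)) => //; rewrite pickleK ifT// inE.
  by move=> [n _]; case: (unpickle n) => // i; case: ifPn => //; rewrite inE => hi /= ->.
apply: bigcupT_measurable => n; case: (unpickle n) => // i.
by case: ifP.
Qed.

(** Rounding to a lattice factors through a countable type, and [phi \o f] is
    the limit of its values at rounded arguments.  This avoids any comparison
    of the Borel sigma-algebra of the matrix space with a product one. *)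
Lemma measurable_continuous_matrix (f : T -> 'M[R]_(k, d)) (phi : 'M[R]_(k, d) -> R) :
  (forall i j, measurable_fun setT (fun w => f w i j)) -> continuous phi ->
  measurable_fun setT (phi \o f).
Proof.
move=> mf cphi.
pose rho (m : nat) : R := m.+1%:R^-1.
have rho0 m : 0 < rho m by rewrite invr_gt0.
pose h m (z : 'M[int]_(k, d)) := phi (\matrix_(i, j) (rho m * (z i j)%:~R)).
apply: (@measurable_fun_cvg _ _ _ _ (fun m => h m \o (floor_mx (rho m) \o f))).
  move=> m; apply: measurable_through_countable => z.
  exact: measurable_floor_mx.
move=> w _; rewrite /h/=.
apply: (@cvg_comp _ _ _ (fun m => \matrix_(i, j) (rho m * (floor_mx (rho m) (f w) i j)%:~R))
   phi \oo (nbhs (f w))); last exact: cphi.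
apply/cvgrPdist_le => e e0.
have rho_cvg : rho m @[m --> \oo] --> (0 : R).
  exact: (@cvg_harmonic R).
have /cvgrPdist_le/(_ _ e0) := rho_cvg.
apply: filterS => m; rewrite sub0r normrN (ger0_norm (ltW (rho0 m))) => me.
exact: le_trans (floor_mx_norm _ _) me.
Qed.

End discretisation.

Lemma coord_le_enorm (R : realType) (d : nat) (x : 'rV[R]_d) i : `|x 0 i| <= enorm x.
Proof.
rewrite -sqrtr_sqr; apply: ler_wsqrtr; rewrite (bigD1 i)//= lerDl.
by apply: sumr_ge0 => j _; exact: sqr_ge0.
Qed.

Section evaluation.
Context {R : realType} {d : nat}.

(** Time changes near the identity move the point [s] only slightly within the
    open interval; an evaluation at a fixed time would not be J1-semicontinuous. *)
Lemma open_value_lt (i : 'I_d) (a b c : R) :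
  open [set f : D01 R d | exists s : unit_itv R, a < val s < b /\ f s 0 i < c].
Proof.
rewrite openE => /= f [s [/andP[as_ sb] fc]].
pose r := Num.min (c - f s 0 i) (Num.min (val s - a) (b - val s)).
have r0 : 0 < r by rewrite !lt_min !subr_gt0 fc as_ sb.
rewrite /interior; apply/nbhs_ballP; exists r => //= g.
move=> /J1_dist_ltP[l [e [[bl _] er fg lid]]].
have [k lk kl] := bl; exists (k s).
have := fg (k s); have := lid (k s); rewrite !kl => ls fgs.
have := le_trans (coord_le_enorm _ i) fgs; rewrite !mxE.
move: er; rewrite !lt_min => /andP[ec /andP[ea eb]].
move: ls; rewrite !ler_norml => /andP[? ?] /andP[? ?].
by split; [change (a < val (k s) < b); apply/andP; split|]; lra.
Qed.

(** By right continuity, [f t 0 i > c] if and only if, for some [q] and [m], no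
    [s] in ]t, t + 1/(m+1)[ has [f s 0 i < c + 1/(q+1)]; these conditions are
    complements of J1-open sets. *)
Lemma measurable_eval (dT : measure_display) (T : measurableType dT)
    (X : T -> borel (D01 R d)) (t : unit_itv R) (i : 'I_d) :
  measurable_fun setT X -> val t < 1 ->
  measurable_fun setT (fun w => (X w : D01 R d) t 0 i).
Proof.
move=> mX t1; apply: (measurability _ (RGenOInfty.measurableE R)).
move=> _ [_ [c ->] <-]; rewrite setTI.
pose U (q m : nat) := [set f : D01 R d | exists s : unit_itv R,
  val t < val s < val t + m.+1%:R^-1 /\ f s 0 i < c + q.+1%:R^-1].
have -> : (fun w => (X w : D01 R d) t 0 i) @^-1` `]c, +oo[%classic =
    \bigcup_q \bigcup_m (X @^-1` ~` U q m).
  apply/seteqP; split => w /=; rewrite in_itv/= andbT.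
    move=> cX.
    have [q qc] : exists q : nat, c + q.+1%:R^-1 < (X w : D01 R d) t 0 i.
      have /archi_boundP : 0 <= ((X w : D01 R d) t 0 i - c)^-1 by rewrite invr_ge0 subr_ge0 ltW.
      set q := Num.bound _ => qP; exists q.
      rewrite -ltrBrDl invf_plt ?posrE ?subr_gt0// (lt_trans qP)// ltr_nat//.
    exists q => //.
    have e0 : 0 < (X w : D01 R d) t 0 i - (c + q.+1%:R^-1) by rewrite subr_gt0.
    have [r r0 rX] := nbhs_unit_itv
      (cvg_enorm _ e0 (@D01_right_continuous _ _ (X w : D01 R d) t)).
    have /archi_boundP : 0 <= r^-1 by rewrite invr_ge0 ltW.
    set m := Num.bound _ => mP; exists m => //.
    have mr : m.+1%:R^-1 < r by rewrite invf_plt ?posrE// (lt_trans mP)// ltr_nat.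
    move=> [s [/andP[ts st] Xs]].
    have /rX : `|val s - val t| < r by rewrite gtr0_norm ?subr_gt0// ltrBlDl (lt_trans st)// ltrD2l.
    move=> /(_ ts) /(le_lt_trans (coord_le_enorm _ i)); rewrite !mxE ltr_norml.
    have absurd (x y z : R) : y < z -> - (x - z) < y - x -> False by clear; move=> *; lra.
    by move=> /andP[+ _]; exact: absurd Xs.
  move=> [q _ [m _ nU]]; rewrite ltNge; apply/negP => Xc.
  have q0 : 0 < q.+1%:R^-1 :> R by rewrite invr_gt0.
  have [r r0 rX] := nbhs_unit_itv
      (cvg_enorm _ q0 (@D01_right_continuous _ _ (X w : D01 R d) t)).
  pose e := Num.min (1 - val t) (Num.min r m.+1%:R^-1) / 2.
  have e0 : 0 < e by rewrite divr_gt0// !lt_min subr_gt0 t1 r0 invr_gt0/=.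
  have [e1 er em] : [/\ e <= 1 - val t, e < r & e < m.+1%:R^-1].
    have : 2 * e <= Num.min (1 - val t) (Num.min r m.+1%:R^-1) by rewrite /e mulrC divfK.
    have small (x z : R) : 0 < x -> 2 * x <= z -> x < z by clear; move=> *; lra.
    rewrite !le_min => /andP[? /andP[? ?]].
    by split; [apply: ltW|..]; exact: small.
  have /andP[t0 _] := unit_itvP t.
  have sE : val (unit_proj (val t + e)) = val t + e
    by rewrite val_unit_proj// addr_ge0 ?(ltW e0)//= -lerBrDl.
  apply: nU; exists (unit_proj (val t + e)); split; first by rewrite sE ltrDl e0 ltrD2l.
  have /rX : `|val (unit_proj (val t + e)) - val t| < r.
    by rewrite sE addrAC subrr add0r gtr0_norm.
  have ts : [set s | val t < val s] (unit_proj (val t + e)).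
    by change (val t < val (unit_proj (val t + e))); rewrite sE ltrDl.
  move=> /(_ ts) /(le_lt_trans (coord_le_enorm _ i)); rewrite !mxE ltr_norml.
  have close (x y z u : R) : x <= z -> y - x < u -> y < z + u by clear; move=> *; lra.
  by move=> /andP[_]; exact: close Xc.
apply: bigcupT_measurable => q; apply: bigcupT_measurable => m.
rewrite -[X in measurable X]setTI; apply: mX => //.
apply: measurableC; apply: sub_sigma_algebra; exact: open_value_lt.
Qed.

End evaluation.

(** * The Markov property over several steps *)
Section restricted_law.
Context {R : realType} {dT dE : measure_display}.
Context {T : measurableType dT} {E : measurableType dE}.
Variables (P : probability T R) (Z : {RV P >-> E}).

Definition restricted_law (B : set T) (A : set E) : \bar R := P (B `&` Z @^-1` A).

Section measure.
Variables (B : set T) (mB : measurable B).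

Let mZ A : measurable A -> measurable (B `&` Z @^-1` A).
Proof.
by move=> mA; apply: measurableI => //; rewrite -[X in measurable X]setTI; apply: measurable_funPT.
Qed.

(** The measurability of [B] is an argument so that the constant can carry the
    structure of a sub-probability. *)
Definition sub_law (_ : measurable B) := restricted_law B.

Let law0 : sub_law mB set0 = 0%E.
Proof. by rewrite /sub_law /restricted_law preimage_set0 setI0 measure0. Qed.

Let law_ge0 A : (0 <= sub_law mB A)%E. Proof. exact: measure_ge0. Qed.

Let law_sigma_additive : semi_sigma_additive (sub_law mB).
Proof.
move=> F mF tF mUF; rewrite /sub_law /restricted_law preimage_bigcup setI_bigcupr.
apply: measure_semi_sigma_additive.
- by move=> i; exact: mZ.
- apply/trivIsetP => i j _ _ ij; rewrite setIACA setIid -preimage_setI.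
  by move/trivIsetP : tF => ->//; rewrite preimage_set0 setI0.
- by rewrite -setI_bigcupr -preimage_bigcup; exact: mZ.
Qed.

HB.instance Definition _ := isMeasure.Build _ _ _ (sub_law mB)
  law0 law_ge0 law_sigma_additive.

Let law_setT : (sub_law mB setT <= 1)%E.
Proof. exact: probability_le1 (mZ measurableT). Qed.

HB.instance Definition _ := Measure_isSubProbability.Build _ _ _ (sub_law mB) law_setT.

Definition giry_law : giry E R := sub_law mB.

Lemma integral_giry_law (g : E -> \bar R) : measurable_fun setT g ->
  (forall x, 0 <= g x)%E -> (\int[giry_law]_x g x = \int[P]_(w in B) g (Z w))%E.
Proof.
move=> mg g0.
transitivity (\int[pushforward (mrestr P mB) Z]_x g x)%E.
  by apply: eq_measure_integral => A mA _ /=; rewrite /pushforward/= /mrestr /sub_law /restricted_law setIC.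
rewrite ge0_integral_pushforward//=.
have mgZ : measurable_fun setT (g \o Z) by exact: measurableT_comp.
rewrite preimage_setT (@ge0_negligible_integral _ _ _ _ _ (~` B))//=; last 2 first.
- exact: measurableC.
- by rewrite /mrestr setICl measure0.
rewrite setDE setCK setTI; apply: eq_measure_integral => A mA AB.
by rewrite -[in RHS](setIidl AB).
Qed.

End measure.
End restricted_law.

Section kernel_as_giry.
Context {R : realType} {dE : measure_display} {E : measurableType dE}.
Variable k : R.-spker E ~> E.

(** The law [k x] under a name to which the sub-probability structure can be
    attached. *)
Definition kernel_at (x : E) : set E -> \bar R := k x.

HB.instance Definition _ x := Measure.copy (kernel_at x) (k x).

HB.instance Definition _ x := Measure_isSubProbability.Build _ _ _ (kernel_at x)
  (sprob_kernel_le1 k x).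

Definition giry_kernel (x : E) : giry E R := kernel_at x.

Lemma measurable_giry_kernel : measurable_fun setT giry_kernel.
Proof.
apply: measurable_giry_codensity => // B mB; exact: measurable_kernel.
Qed.

(** Integration against the mixture of the laws [k x] under [mu] is an iterated
    integral: this is associativity in the Giry monad. *)
Lemma integral_of_mixture (mu nu : giry E R) (g : E -> \bar R) :
  (forall A, measurable A -> nu A = \int[mu]_x k x A)%E ->
  measurable_fun setT g -> (forall x, 0 <= g x)%E ->
  (\int[nu]_y g y = \int[mu]_x \int[k x]_y g y)%E.
Proof.
move=> nuE mg g0.
rewrite -[RHS]/(giry_int mu (fun x => giry_int (giry_kernel x) g)).
rewrite -(giry_int_bind mu measurable_giry_kernel)//.
apply: eq_measure_integral => A mA _.
transitivity (\int[mu]_x k x A)%E; first exact: nuE.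
by apply/esym/giry_int_map; [exact: measurable_giry_ev|move=> m; exact: measure_ge0].
Qed.

End kernel_as_giry.

Section past.
Context {R : realType} {dE : measure_display} {E : measurableType dE}.
Context {dT : measure_display} {T : measurableType dT} {P : probability T R}.
Variable Y : nat -> {RV P >-> E}.

Lemma past_measurable k B : past Y k B -> measurable B.
Proof.
apply: smallest_sub; first by split => //;
  [move=> A mA; rewrite setTD; exact: measurableC|move=> A; exact: bigcupT_measurable].
by move=> _ [i _ [A mA <-]]; exact: measurable_funPT.
Qed.

Lemma past_mono k l : (k <= l)%N -> past Y k `<=` past Y l.
Proof.
move=> kl; apply: sub_sigma_algebra2 => _ [i /= ik [A mA <-]].
by exists i; [exact: leq_trans ik _|exists A].
Qed.

Lemma past_preimage k i A : (i <= k)%N -> measurable A -> past Y k (Y i @^-1` A).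
Proof.
move=> ik mA; apply: sub_sigma_algebra; exists i => //=.
by exists A => //; rewrite setTI.
Qed.

Lemma pastT k : past Y k setT.
Proof. by rewrite -setC0; apply: sigma_algebraC; exact: sigma_algebra0. Qed.

Lemma pastC k B : past Y k B -> past Y k (~` B).
Proof. exact: sigma_algebraC. Qed.

Lemma past_bigcup k (B : nat -> set T) : (forall i, past Y k (B i)) ->
  past Y k (\bigcup_i B i).
Proof. exact: sigma_algebra_bigcup. Qed.

Lemma pastU k A B : past Y k A -> past Y k B -> past Y k (A `|` B).
Proof.
move=> pA pB; rewrite -bigcup2E; apply: past_bigcup => -[//|[//|i]] /=.
by rewrite -[X in past _ _ X]setCK setC0; apply: pastC; exact: pastT.
Qed.

Lemma pastI k A B : past Y k A -> past Y k B -> past Y k (A `&` B).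
Proof.
move=> pA pB; rewrite -[X in past _ _ X]setCK setCI.
by apply: pastC; apply: pastU; exact: pastC.
Qed.

Lemma pastD k A B : past Y k A -> past Y k B -> past Y k (A `\` B).
Proof. by move=> pA pB; rewrite setDE; apply: pastI => //; exact: pastC. Qed.

End past.

Section markov_property.
Context {R : realType} {dE : measure_display} {E : measurableType dE}.
Variable K : R.-pker E ~> E.
Context {dT : measure_display} {T : measurableType dT} {P : probability T R}.
Variable Y : nat -> {RV P >-> E}.
Hypothesis YK : is_markov_chain K Y.

(** Induction on [j]: the one-step Markov property integrates the kernel
    against the law of [Y (k + j)] restricted to [B], which by induction is a
    mixture of the kernels started from [Y k]. *)
Lemma markov_iter k j A B : past Y k B -> measurable A ->
  (P (B `&` Y (k + j)%N @^-1` A) = \int[P]_(w in B) kernel_iter K j (Y k w) A)%E.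
Proof.
move=> pB; have mB := past_measurable pB.
elim: j A => [|j IH] A mA.
  have mYA : measurable (Y k @^-1` A) := past_measurable (past_preimage (leqnn k) mA).
  rewrite addn0 setIC -(integral_indic _ mB)//.
rewrite addnS YK//; last exact: past_mono (leq_addr _ _) _ pB.
have mK : measurable_fun setT (fun y => K y A) by exact: measurable_kernel.
rewrite -(integral_giry_law _ mB mK)//.
rewrite (@integral_of_mixture _ _ _ (kernel_iter K j) (giry_law (Y k) mB))//; last first.
  move=> C mC; rewrite integral_giry_law//; first exact: IH.
  exact: measurable_kernel.
rewrite integral_giry_law//.
  exact: (measurable_kernel (kernel_iter K j.+1)).
by move=> x; exact: integral_ge0.
Qed.

End markov_property.

(** * Increments of the chain given its past *)
Section enorm_continuity.
Context {R : realType} {d : nat}.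

Lemma enorm_distC (x y : 'rV[R]_d) : enorm (x - y) = enorm (y - x).
Proof. by rewrite -enormN opprB. Qed.

Lemma enorm_triangle (y x z : 'rV[R]_d) : enorm (x - z) <= enorm (x - y) + enorm (y - z).
Proof. by rewrite -[x - z](subrKA y); exact: ler_enormD. Qed.

Lemma ler_dist_enorm (x y : 'rV[R]_d) : `|enorm x - enorm y| <= enorm (x - y).
Proof.
have := ler_enormD (y - x) x; have := ler_enormD (x - y) y.
rewrite !subrK (enorm_distC y) => h1 h2.
by rewrite ler_norml; apply/andP; split; lra.
Qed.

Lemma continuous_enorm_sub (x : 'rV[R]_d) : continuous (fun y : 'rV[R]_d => enorm (y - x)).
Proof.
move=> y; have FF : Filter (nbhs y) by exact: nbhs_filter.
apply/cvgrPdist_le => /= e e0.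
apply: filterS (cvg_enorm _ e0 (@cvg_id _ (nbhs y))) => z zy.
rewrite (le_trans (ler_dist_enorm _ _))// opprB addrA subrK.
by rewrite enorm_distC ltW.
Qed.

Lemma continuous_enorm : continuous (@enorm R d).
Proof.
move=> y; have := @continuous_enorm_sub 0 y.
by under eq_fun do rewrite subr0.
Qed.

Lemma open_far (x : 'rV[R]_d) (c : R) : open [set y | c < enorm (y - x)].
Proof.
have : open ((fun y : 'rV[R]_d => enorm (y - x)) @^-1` [set z : R | z > c]).
  by apply: open_comp => [y _|]; [exact: continuous_enorm_sub|exact: open_gt].
exact.
Qed.

End enorm_continuity.

Section chain_increments.
Context {R : realType} {d : nat}.
Local Notation E := (borel 'rV[R]_d).
Context {dT : measure_display} {T : measurableType dT} {P : probability T R}.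
Variable Y : nat -> {RV P >-> E}.

(** The sample space with the past up to time [k] as its sigma-algebra:
    measurability for it is membership in [past Y k]. *)
Local Notation history k := (g_sigma_algebraType (\bigcup_(i in `I_k.+1)
  preimage_set_system setT (Y i) measurable)).

Lemma past_measurable_coord k a j : (a <= k)%N ->
  measurable_fun [set: history k] (fun w : T => (Y a w : 'rV[R]_d) 0 j).
Proof.
move=> ak.
apply: (@continuous_borel_measurable R 'rV[R]_d _ (history k) (Y a)
  (fun x : 'rV[R]_d => x 0 j)).
  by move=> _ A mA; rewrite setTI; exact: past_preimage.
exact: coord_continuous.
Qed.

Lemma past_far k a b (c : R) : (a <= k)%N -> (b <= k)%N ->
  past Y k [set w | c < enorm ((Y b w : 'rV[R]_d) - Y a w)].
Proof.
move=> ak bk.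
have mc i j : measurable_fun [set: history k]
    (fun w : T => ((Y b w : 'rV[R]_d) - Y a w) i j).
  rewrite [X in measurable_fun _ X](_ : _ = (fun w : T =>
      (Y b w : 'rV[R]_d) 0 j - (Y a w : 'rV[R]_d) 0 j)); last first.
    by apply/funext => w; rewrite !mxE ord1.
  by apply: measurable_funB; exact: past_measurable_coord.
have := @measurable_continuous_matrix R 1 d _ (history k)
  (fun w : T => (Y b w : 'rV[R]_d) - Y a w) (@enorm R d) mc continuous_enorm.
move=> /(_ measurableT `]c, +oo[%classic (measurable_itv _)).
rewrite setTI; congr (past Y k _).
by apply/seteqP; split => w /=; rewrite in_itv/= andbT.
Qed.

Lemma past_norm_lt k a (r : R) : (a <= k)%N -> past Y k [set w | enorm (Y a w) < r].
Proof.
move=> ak.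
have oB : open (@enorm R d @^-1` [set z : R | z < r]).
  by apply: open_comp => [x _|]; [exact: continuous_enorm|exact: open_lt].
have mB : measurable (@enorm R d @^-1` [set z : R | z < r] : set E).
  exact: sub_sigma_algebra.
exact: past_preimage ak mB.
Qed.

Variable K : R.-pker E ~> E.
Hypothesis YK : is_markov_chain K Y.

(** The Markov property concerns sets of positions that are fixed in advance,
    whereas here the ball is centred at the random point [Y l].  So [B] is cut
    according to the lattice cell that contains [Y l], and on each part the
    centre is replaced by a vertex of the cell, at a distance at most
    [eps / 4] from [Y l].  The passage to the vertex and back accounts for the
    loss from [eps] to [eps / 2]. *)
Lemma increment_le l j (r eps alpha : R) B : 0 < eps -> 0 <= alpha ->
  (forall x, enorm x < r ->
    (kernel_iter K j x [set y | (eps / 2 < enorm (y - x))%R] <= alpha%:E)%E) ->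
  past Y l B -> B `<=` [set w | enorm (Y l w) < r] ->
  (P (B `&` [set w | (eps < enorm ((Y (l + j)%N w : 'rV[R]_d) - Y l w))%R])
     <= alpha%:E * P B)%E.
Proof.
move=> eps0 alpha0 Kle pB Br.
have s0 : 0 < Num.sqrt d%:R + 1 :> R by rewrite ltr_wpDl// sqrtr_ge0.
(* the Euclidean diameter of a cell of side rho is at most eps / 4 *)
pose rho : R := eps / 4 / (Num.sqrt d%:R + 1).
have rho0 : 0 < rho by rewrite !divr_gt0.
have rhod : Num.sqrt d%:R * rho <= eps / 4.
  rewrite /rho mulrCA ler_piMr ?divr_ge0 ?ltW//.
  by rewrite ltr_pdivrMr// mul1r ltrDl.
pose cell (w : T) : nat := pickle (floor_mx rho (Y l w : 'rV[R]_d)).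
pose Bn n := B `&` [set w | cell w = n].
pose far := [set w | eps < enorm ((Y (l + j)%N w : 'rV[R]_d) - Y l w)].
have mB := past_measurable pB.
have pBn n : past Y l (Bn n).
  apply: pastI => //.
  rewrite (_ : [set w | _] = if (unpickle n : option 'M[int]_(1, d)) is Some z
      then if pickle z == n then [set w | floor_mx rho (Y l w : 'rV[R]_d) = z] else set0 else set0).
    case: (unpickle n) => [z|]; last exact: sigma_algebra0.
    case: ifP => _; last exact: sigma_algebra0.
    apply: (@measurable_floor_mx R 1 d _ (history l) rho (fun w : T => (Y l w : 'rV[R]_d)) z rho0).
    by move=> i i'; rewrite ord1; exact: past_measurable_coord.
  apply/seteqP; split => w /=.
    by move=> <-; rewrite pickleK eqxx.
  case: (unpickle n) => [z|//]; case: eqP => //= zn wz.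
  by rewrite /cell wz.
have mBn n := past_measurable (pBn n).
have mfar : measurable far.
  exact: past_measurable (past_far eps (leq_addr j l) (leqnn _)).
have tB : trivIset setT Bn.
  apply/trivIsetP => a b _ _ /eqP ab; apply/seteqP; split => // w [[_ wa] [_ wb]].
  by case: ab; exact: etrans (esym wa) wb.
have BE : B = \bigcup_n Bn n.
  apply/seteqP; split => [w Bw|w [n _ []]//]; first by exists (cell w).
have step n : (P (Bn n `&` far) <= alpha%:E * P (Bn n))%E.
  have [->|/set0P[w0 [_ w0n]]] := eqVneq (Bn n) set0.
    by rewrite set0I measure0 mule0.
  pose z := floor_mx rho (Y l w0 : 'rV[R]_d).
  pose x0 : 'rV[R]_d := \matrix_(i, j) (rho * (z i j)%:~R).
  have near_x0 w : Bn n w -> enorm ((Y l w : 'rV[R]_d) - x0) <= eps / 4.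
    move=> [_ wn]; have /(pcan_inj pickleK) wz : cell w = cell w0 by rewrite wn w0n.
    rewrite (le_trans (enorm_le_norm _))// (le_trans _ rhod)//.
    rewrite ler_wpM2l ?sqrtr_ge0// /x0 /z -wz.
    exact: floor_mx_norm.
  pose A := [set y : 'rV[R]_d | eps - eps / 4 < enorm (y - x0)].
  have mA : measurable (A : set E) by apply: sub_sigma_algebra; exact: open_far.
  apply: (@le_trans _ _ (P (Bn n `&` Y (l + j)%N @^-1` A))).
    apply: le_measure; rewrite ?inE.
    - exact: measurableI.
    - apply: measurableI => //.
      exact: past_measurable (past_preimage (leqnn _) mA).
    - move=> w [Bw fw]; split => //=; rewrite /A/=.
      have := enorm_triangle x0 (Y (l + j)%N w) (Y l w).
      have := near_x0 w Bw; rewrite (enorm_distC x0); rewrite /far/= in fw.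
      by move=> h1 h2; rewrite ltrBlDr (lt_le_trans fw)// (le_trans h2)// lerD2l.
  rewrite (markov_iter YK)// -(integral_cst P (mBn n))//.
  apply: ge0_le_integral => //.
  - apply: measurable_funTS.
    have mk : measurable_fun setT (fun x => kernel_iter K j x A) by exact: measurable_kernel.
    exact: (measurableT_comp mk).
  - move=> w Bw; apply: (le_trans _ (Kle (Y l w) _)); last by case: Bw => /Br.
    apply: le_measure; rewrite ?inE//.
      by apply: sub_sigma_algebra; exact: open_far.
    move=> y /=; rewrite /A/= => yx0.
    have := enorm_triangle (Y l w) y x0; have := near_x0 w Bw.
    move=> h1 h2; have : eps - eps / 4 < enorm (y - Y l w) + eps / 4.
      by rewrite (lt_le_trans yx0)// (le_trans h2)// lerD2l.
    by move: eps0; set u := enorm _; move=> ? ?; lra.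
rewrite {1}BE setI_bigcupl.
rewrite measure_bigcup//=; last 2 first.
- by move=> n _; exact: measurableI.
- by apply/trivIsetP => a b _ _ ab; rewrite setIACA (trivIsetP.1 tB)// set0I.
rewrite [in X in (_ <= _ * X)%E]BE measure_bigcup//= -nneseriesZl//.
by apply: lee_nneseries => n _ //.
Qed.

End chain_increments.

(** * Exit times and slow oscillation of the step path *)
Section exit_times.
Context {R : realType} {d : nat}.
Variables (r eps : R).
Implicit Types y : nat -> 'rV[R]_d.

(** The first time [k] after [l] at which the path is farther than [eps] from
    [y l].  Both positions are required to lie in the ball of radius [r], where
    the transition kernels are controlled. *)
Definition exits y (l k : nat) : Prop :=
  [/\ (l < k)%N, enorm (y l) < r, enorm (y k) < r, eps < enorm (y k - y l) &
      forall i, (l < i < k)%N -> enorm (y i - y l) <= eps].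

(** [k] is the [i]-th time of the sequence of successive exits that starts at 0;
    this is a relation because the sequence may stop. *)
Fixpoint exit_time y (i k : nat) : Prop :=
  if i is i'.+1 then exists l, exit_time y i' l /\ exits y l k else k = 0%N.

Lemma exits_inj y l k k' : exits y l k -> exits y l k' -> k = k'.
Proof.
have absurd a b : exits y l a -> exits y l b -> ~ (a < b)%N.
  move=> [la _ _ far _] [_ _ _ _ near] ab.
  by have := near a; rewrite la ab leNgt far => /(_ isT).
move=> ka kb; apply/eqP; case: ltngtP => // /absurd; first by move/(_ ka kb).
by move/(_ kb ka).
Qed.

Lemma near_until_exit y l m : (forall k, (l <= k <= m)%N -> enorm (y k) < r) ->
  (forall k, (k <= m)%N -> ~ exits y l k) ->
  forall k, (l <= k <= m)%N -> 0 <= eps -> enorm (y k - y l) <= eps.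
Proof.
move=> yr nex k lkm eps0; elim/ltn_ind: k lkm => k IH /andP[lk km].
have [->|kl] := eqVneq k l; first by rewrite subrr enorm0.
have {kl}lk' : (l < k)%N by rewrite ltn_neqAle eq_sym kl.
rewrite leNgt; apply/negP => far; apply: (nex k km); split => //.
- by rewrite yr// leqnn (leq_trans lk).
- by rewrite yr// lk.
- by move=> i /andP[li ik]; rewrite IH// (ltnW li)/= (leq_trans (ltnW ik)).
Qed.

Section step_path.
Variables (n : nat) (y : nat -> 'rV[R]_d).
Hypotheses (n0 : (0 < n)%N) (eps0 : 0 <= eps).

Lemma step_path_index (t : unit_itv R) (l : nat) : (l < n)%N -> l%:R / n%:R <= val t ->
  exists2 i, step_path n y t = y i & (l <= i < n)%N /\
    forall k, val t < k%:R / n%:R -> (i < k)%N.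
Proof.
move=> ln lt; have nR0 : 0 < n%:R :> R by rewrite ltr0n.
have /andP[t0 t1] := unit_itvP t.
rewrite /step_path/= /step_fun; have [tlt1|tge1] := ltP (val t) 1.
  have nt0 : 0 <= n%:R * val t by rewrite mulr_ge0.
  exists (Num.truncn (n%:R * val t)) => //; split.
    rewrite truncn_ge_nat// truncn_lt_nat// -ler_pdivrMl// mulrC lt/=.
    by rewrite gtr_pMr.
  by move=> k; rewrite truncn_lt_nat// ltr_pdivlMr// mulrC.
exists n.-1 => //; split; first by rewrite -ltnS prednK// ln leqnn.
move=> k; rewrite ltr_pdivlMr// => h; rewrite prednK// -(ler_nat R).
by rewrite (le_trans _ (ltW h))// ler_peMl.
Qed.

(** The exit times up to [n - D.+1] bound the pieces, on each of which the path
    stays within [eps] of its initial value.  After the last of them, [l], the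
    path stays within [eps] of [y l] until time [n - D.+1], and from then on
    within [eps] of [y (n - D.+1)], hence within [2 * eps] of [y l]; so the
    oscillation on the last piece is at most [4 * eps].  Stopping at
    [n - D.+1] makes the last piece longer than [del]. *)
Lemma step_path_slowly_oscillating (N D : nat) (del : R) : (D < n)%N ->
  del * n%:R < D.+1%:R ->
  (forall k, (k <= n)%N -> enorm (y k) < r) ->
  (forall k, (k <= n)%N -> ~ exit_time y N k) ->
  (forall i l k, (i < N)%N -> (k <= n)%N -> (k <= l + D)%N ->
     exit_time y i l -> ~ exits y l k) ->
  (forall k, (k < n)%N -> ~ exits y (n - D.+1)%N k) ->
  slowly_oscillating (step_path n y) (4 * eps) del.
Proof.
move=> Dn delD yr noN gaps last.
have nR0 : 0 < n%:R :> R by rewrite ltr0n.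
pose L := (n - D.+1)%N.
have LD : (L + D.+1 = n)%N by rewrite subnK.
have Ln : (L < n)%N by rewrite -LD addnS ltnS leq_addr.
have gap l k : (l + D < k)%N -> l%:R / n%:R + del < k%:R / n%:R.
  move=> ldk; rewrite -ltrBrDl -mulrBl ltr_pdivlMr// (lt_le_trans delD)//.
  by rewrite lerBrDl -natrD ler_nat addnS.
have part0 : slow_partition (step_path n y) (4 * eps) del (0%N%:R / n%:R).
  by rewrite mul0r; exact: slow_partition0.
have partS l k : (l < n)%N -> (l + D < k)%N -> exits y l k ->
    slow_partition (step_path n y) (4 * eps) del (l%:R / n%:R) ->
    slow_partition (step_path n y) (4 * eps) del (k%:R / n%:R).
  move=> ln ldk [lk _ _ _ near] pl; apply: (slow_partitionS pl); first exact: gap.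
  have near' i : (l <= i < k)%N -> enorm (y i - y l) <= eps.
    move=> /andP[]; rewrite leq_eqVlt => /predU1P[<- _|li ik].
      by rewrite subrr enorm0.
    by rewrite near// li.
  move=> u v /andP[lu uk] /andP[lv vk].
  have [i -> [/andP[li _] ik]] := step_path_index ln lu.
  have [j -> [/andP[lj _] jk]] := step_path_index ln lv.
  have hi : enorm (y i - y l) <= eps by apply: near'; rewrite li ik.
  have hj : enorm (y j - y l) <= eps by apply: near'; rewrite lj jk.
  rewrite (le_trans (enorm_triangle (y l) _ _))// (enorm_distC (y l)).
  by move: hi hj eps0; lra.
suff [l [lL pl lastl]] : exists l, [/\ (l <= L)%N,
    slow_partition (step_path n y) (4 * eps) del (l%:R / n%:R) &
    forall k, (k <= L)%N -> ~ exits y l k].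
  exists (l%:R / n%:R); split => //.
    have := gap l n; rewrite divff ?gt_eqF//; apply.
    by rewrite -[ltnRHS]LD addnS ltnS leq_add2r.
  have ln := leq_ltn_trans lL Ln.
  have near i : (l <= i < n)%N -> enorm (y i - y l) <= 2 * eps.
    move=> /andP[li i_n]; have [iL|Li] := leqP i L.
      have : enorm (y i - y l) <= eps.
        apply: (@near_until_exit y l L) => //; last by rewrite li.
        by move=> k /andP[_ kL]; apply: yr; rewrite (leq_trans kL)// ltnW.
      by move=> h; rewrite (le_trans h)// ler_peMl// ler1n.
    have h1 : enorm (y L - y l) <= eps.
      apply: (@near_until_exit y l L) => //; last by rewrite lL leqnn.
      by move=> k /andP[_ kL]; apply: yr; rewrite (leq_trans kL)// ltnW.
    have h2 : enorm (y i - y L) <= eps.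
      apply: (@near_until_exit y L n.-1) => //.
      + by move=> k /andP[_ kn]; apply: yr; rewrite (leq_trans kn)// leq_pred.
      + by move=> k kn; apply: last; rewrite -(prednK n0) ltnS.
      + by rewrite (ltnW Li) -ltnS prednK.
    by rewrite (le_trans (enorm_triangle (y L) _ _))// mulr2n mulrDl mul1r lerD.
  move=> u v lu lv.
  have [i -> [lin _]] := step_path_index ln lu.
  have [j -> [ljn _]] := step_path_index ln lv.
  have hi := near i lin; have hj := near j ljn.
  rewrite (le_trans (enorm_triangle (y l) _ _))// (enorm_distC (y l)).
  by move: hi hj; lra.
(* if there were no last exit time before L, there would be N of them *)
apply: contrapT => noL.
have {}noL l : (l <= L)%N -> slow_partition (step_path n y) (4 * eps) del (l%:R / n%:R) ->
    exists2 k, (k <= L)%N & exits y l k.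
  move=> lL pl; apply: contrapT => nok; apply: noL; exists l; split => // k kL lk.
  by apply: nok; exists k.
have reach i : (i <= N)%N -> exists l, [/\ (l <= L)%N, exit_time y i l &
    slow_partition (step_path n y) (4 * eps) del (l%:R / n%:R)].
  elim: i => [_|i IH iN]; first by exists 0%N.
  have [l [lL il pl]] := IH (ltnW iN).
  have [k kL lk] := noL l lL pl.
  exists k; split => //; first by exists l.
  apply: (partS l) => //; first exact: leq_ltn_trans Ln.
  rewrite ltnNge; apply/negP => kl.
  by apply: (gaps i l k) => //; rewrite (leq_trans kL)// ltnW.
have [l [lL Nl _]] := reach N (leqnn _).
by apply: (noN l) => //; rewrite (leq_trans lL)// ltnW.
Qed.

End step_path.
End exit_times.

(** * Probabilities of exits *)
Section real_probability.
Context {R : realType} {dT : measure_display} {T : measurableType dT}.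
Variable P : probability T R.
Implicit Types A B U : set T.

Definition pr A : R := fine (P A).

Lemma prE A : measurable A -> (pr A)%:E = P A.
Proof. by move=> mA; rewrite /pr fineK// fin_num_measure. Qed.

Lemma pr_ge0 A : 0 <= pr A.
Proof. by rewrite /pr fine_ge0. Qed.

Lemma pr_set0 : pr set0 = 0. Proof. by rewrite /pr measure0. Qed.

Lemma pr_setT : pr setT = 1. Proof. by rewrite /pr (@probability_setT _ _ _ P). Qed.

Lemma le_pr A B : measurable A -> measurable B -> A `<=` B -> pr A <= pr B.
Proof.
by move=> mA mB AB; rewrite -lee_fin !prE// le_measure// inE.
Qed.

Lemma pr_setU_le A B : measurable A -> measurable B -> pr (A `|` B) <= pr A + pr B.
Proof.
move=> mA mB; rewrite -lee_fin EFinD !prE//; first exact: measureU2.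
exact: measurableU.
Qed.

Lemma pr_setID A B : measurable A -> measurable B -> pr (A `\` B) + pr (A `&` B) = pr A.
Proof.
move=> mA mB; apply: EFin_inj; rewrite EFinD !prE//; last 2 first.
- exact: measurableI.
- exact: measurableD.
by rewrite -[X in _ = P X](setDUK (@subIsetl _ A B)) setDIr setDv set0U setUC measureU//;
  [exact: measurableD|exact: measurableI|rewrite setDE setIACA setICl setI0].
Qed.

Lemma pr_bigcup_le (A : nat -> set T) n : (forall i, measurable (A i)) ->
  (forall i, (n <= i)%N -> A i = set0) -> pr (\bigcup_i A i) <= \sum_(i < n) pr (A i).
Proof.
move=> mA; elim: n A mA => [|n IH] A mA A0.
  rewrite big_ord0 (_ : \bigcup_i A i = set0) ?pr_set0//.
  by apply/seteqP; split => // w [i _]; rewrite A0.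
rewrite big_ord_recl/= (_ : \bigcup_i A i = A 0%N `|` \bigcup_i A i.+1); last first.
  apply/seteqP; split => [w [[|i] _ Aw]|w [Aw|[i _ Aw]]].
  - by left.
  - by right; exists i.
  - by exists 0%N.
  - by exists i.+1.
rewrite (le_trans (pr_setU_le _ _))//; first exact: bigcupT_measurable.
rewrite lerD2l (IH (fun i => A i.+1))// => i ni; exact: A0.
Qed.

Lemma sum_pr_disjoint_le (A : nat -> set T) n (Q : pred nat) U :
  (forall i, measurable (A i)) -> measurable U ->
  (forall i, (i < n)%N -> A i `<=` U) ->
  (forall i j w, A i w -> A j w -> i = j) -> \sum_(i < n | Q i) pr (A i) <= pr U.
Proof.
move=> mA mU AU dA; elim: n U mU AU => [|n IH] U mU AU; first by rewrite big_ord0 pr_ge0.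
rewrite big_mkcond big_ord_recr/= -big_mkcond/=.
have AUn : \sum_(i < n | Q i) pr (A i) <= pr (U `\` A n).
  apply: IH; first exact: measurableD.
  move=> i ni w Aw; split; first by apply: AU Aw; exact: ltnW.
  by move=> /(dA _ _ _ Aw) ni'; rewrite ni' ltnn in ni.
rewrite -(pr_setID mU (mA n)) setIidr ?lerD//; last exact: AU.
by case: ifP => _ //; exact: pr_ge0.
Qed.

Lemma pr_bigcup_cond_le (A : nat -> set T) n (Q : pred nat) (I : set nat) :
  (forall i, measurable (A i)) -> (forall i, I i -> (i < n)%N && Q i) ->
  pr (\bigcup_(i in I) A i) <= \sum_(i < n | Q i) pr (A i).
Proof.
move=> mA IQ.
pose A' i := if (i < n)%N && Q i then A i else set0.
have mA' i : measurable (A' i) by rewrite /A'; case: ifP.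
apply: (@le_trans _ _ (pr (\bigcup_i A' i))).
  apply: le_pr; [exact: bigcup_measurable|exact: bigcupT_measurable|].
  by move=> w [i /IQ Ii Aw]; exists i => //; rewrite /A' Ii.
have A'0 i : (n <= i)%N -> A' i = set0 by rewrite leqNgt /A' => /negbTE ->.
apply: (le_trans (pr_bigcup_le mA' A'0)).
rewrite [leRHS]big_mkcond; apply: ler_sum => i _; rewrite /A' ltn_ord/=.
by case: ifP => //; rewrite pr_set0.
Qed.

End real_probability.

Section exit_probabilities.
Context {R : realType} {d : nat}.
Local Notation E := (borel 'rV[R]_d).
Context {dT : measure_display} {T : measurableType dT} {P : probability T R}.
Variable Y : nat -> {RV P >-> E}.
Variables (r eps : R).
Local Notation pr := (pr P).
Local Notation path w := (fun k => (Y k w : 'rV[R]_d)).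

Definition exit_event l k := [set w | exits r eps (path w) l k].
Definition exit_time_event i k := [set w | exit_time r eps (path w) i k].

Lemma past_exit_event l k : past Y k (exit_event l k).
Proof.
have [lk|kl] := ltnP l k; last first.
  rewrite (_ : exit_event l k = set0); first exact: sigma_algebra0.
  by apply/seteqP; split => // w [lk]; rewrite ltnNge kl in lk.
pose far i := [set w | eps < enorm ((Y i w : 'rV[R]_d) - Y l w)].
pose early i := if (l < i < k)%N then far i else set0.
have -> : exit_event l k = [set w | enorm (Y l w) < r] `&` [set w | enorm (Y k w) < r]
    `&` far k `\` \bigcup_i early i.
  apply/seteqP; split => w.
    move=> [_ rl rk fk near]; split => // -[i _]; rewrite /early; case: ifP => // lik.
    by rewrite /far/= ltNge near.
  move=> [[[rl rk] fk] ne]; split => // i lik; rewrite leNgt; apply/negP => fi.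
  by apply: ne; exists i => //; rewrite /early lik.
apply: pastD.
  apply: pastI; first apply: pastI.
  - by apply: past_norm_lt; exact: ltnW.
  - exact: past_norm_lt.
  - by apply: past_far => //; exact: ltnW.
apply: past_bigcup => i; rewrite /early; case: ifP => [/andP[li ik]|_].
  by apply: past_far; exact: ltnW.
exact: sigma_algebra0.
Qed.

Lemma exit_time_eventS i k :
  exit_time_event i.+1 k = \bigcup_l (exit_time_event i l `&` exit_event l k).
Proof.
by apply/seteqP; split => w [l]; [move=> [il lk]; exists l|move=> _ [il lk]; exists l].
Qed.

Lemma past_exit_time_event i k : past Y k (exit_time_event i k).
Proof.
elim: i k => [|i IH] k.
  rewrite (_ : exit_time_event 0 k = if k == 0%N then setT else set0).
    by case: ifP => _; [exact: pastT|exact: sigma_algebra0].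
  by apply/seteqP; split => w; rewrite /exit_time_event/=; case: eqP.
rewrite exit_time_eventS; apply: past_bigcup => l.
have [lk|kl] := ltnP l k.
  by apply: pastI; [exact: (past_mono (ltnW lk))|exact: past_exit_event].
rewrite (_ : exit_event l k = set0); first by rewrite setI0; exact: sigma_algebra0.
by apply/seteqP; split => // w [lk]; rewrite ltnNge kl in lk.
Qed.

Lemma measurable_exit_event l k : measurable (exit_event l k).
Proof. exact: past_measurable (@past_exit_event l k). Qed.

Lemma measurable_exit_time_event i k : measurable (exit_time_event i k).
Proof. exact: past_measurable (@past_exit_time_event i k). Qed.

Lemma sum_pr_exit_le1 l B n (Q : pred nat) : measurable B ->
  \sum_(k < n | Q k) pr (B `&` exit_event l k) <= pr B.
Proof.
move=> mB; apply: (@sum_pr_disjoint_le _ _ _ P (fun k => B `&` exit_event l k) n Q) => //.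
- by move=> k; apply: measurableI => //; exact: measurable_exit_event.
- by move=> k k' w [_ lk] [_ lk']; exact: exits_inj lk lk'.
Qed.

(** What the transition kernels provide: a bound at fixed times, given a past
    event on which the current position lies in the ball. *)
Definition small_increments H (alpha : R) := forall l j B, (j <= H)%N ->
  past Y l B -> B `<=` [set w | enorm (Y l w) < r] ->
  pr (B `&` [set w | eps / 2 < enorm ((Y (l + j)%N w : 'rV[R]_d) - Y l w)])
    <= alpha * pr B.

Section controlled.
Variables (H : nat) (alpha : R).
Hypothesis alpha0 : 0 <= alpha.
Hypothesis incr : small_increments H alpha.

(** Ottaviani's argument.  If the chain exits at a time [k <= l + H], then either
    it has moved by more than [eps / 2] between [k] and [l + H], or it is
    farther than [eps / 2] from [Y l] at time [l + H].  The probability of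
    either is at most [alpha] times that of [B]: for the first alternative,
    the bound is applied at each [k], and the exits at distinct [k] are
    disjoint. *)
Lemma sum_pr_exit_le l B n : past Y l B ->
  \sum_(k < n | (k <= l + H)%N) pr (B `&` exit_event l k) <= 2 * alpha * pr B.
Proof.
move=> pB; have mB := past_measurable pB.
pose C k := B `&` exit_event l k.
have mC k : measurable (C k) by apply: measurableI => //; exact: measurable_exit_event.
pose B' := B `&` [set w | enorm (Y l w) < r].
have pB' : past Y l B' by apply: pastI => //; exact: past_norm_lt.
have mB' := past_measurable pB'.
pose D := [set w | eps / 2 < enorm ((Y (l + H)%N w : 'rV[R]_d) - Y l w)].
have mD : measurable D.
  by apply: (@past_measurable _ _ _ _ _ _ Y (l + H)); apply: past_far => //; exact: leq_addr.
have prB' : pr B' <= pr B by apply: le_pr => // w [].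
have step k : (k <= l + H)%N -> pr (C k) <= alpha * pr (C k) + pr (C k `&` D).
  move=> klH.
  have [lk|kl] := ltnP l k; last first.
    rewrite (_ : C k = set0) ?set0I ?pr_set0 ?mulr0 ?addr0//.
    by apply/seteqP; split => // w [_ [lk]]; rewrite ltnNge kl in lk.
  pose F := [set w | eps / 2 < enorm ((Y (k + (l + H - k))%N w : 'rV[R]_d) - Y k w)].
  have kE : (k + (l + H - k) = l + H)%N by rewrite subnKC.
  have mF : measurable F.
    by apply: (@past_measurable _ _ _ _ _ _ Y (l + H)); apply: past_far; rewrite ?kE.
  have pC : past Y k (C k).
    by apply: pastI; [exact: past_mono (ltnW lk) _ pB|exact: past_exit_event].
  have CF : pr (C k `&` F) <= alpha * pr (C k).
    apply: incr => //.
      by rewrite leq_subLR leq_add2r ltnW.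
    by move=> w [_ []].
  rewrite -{1}(pr_setID P (mC k) mF) addrC lerD//.
  apply: le_pr; [exact: measurableD|exact: measurableI|].
  move=> w [Cw nF]; split => //.
  move: nF Cw => /negP; rewrite /F /D kE /= -leNgt => near [_ [_ _ _ far _]].
  have := enorm_triangle (Y (l + H)%N w) (Y k w) (Y l w).
  rewrite (enorm_distC (Y k w) (Y (l + H)%N w)).
  by move: near far; set a := enorm _; set b := enorm _; set c := enorm _; move=> *; lra.
have C_le : \sum_(k < n | (k <= l + H)%N) pr (C k) <= pr B'.
  rewrite (_ : \sum_(k < n | _) _ = \sum_(k < n | (k <= l + H)%N) pr (B' `&` exit_event l k)).
    exact: (@sum_pr_exit_le1 l B' n (fun k => k <= l + H)%N).
  apply: eq_bigr => k _; congr (pr _); apply/seteqP; split => w; last by move=> [[]].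
  by move=> [Bw lk]; split => //; split => //; case: lk.
have CD_le : \sum_(k < n | (k <= l + H)%N) pr (C k `&` D) <= alpha * pr B'.
  apply: (@le_trans _ _ (pr (B' `&` D))); last by apply: incr => // w [].
  apply: (@sum_pr_disjoint_le _ _ _ P (fun k => C k `&` D) n (fun k => k <= l + H)%N).
  - by move=> k; exact: measurableI.
  - exact: measurableI.
  - by move=> k _ w [[Bw lk] Dw]; split => //; split => //; case: lk.
  - by move=> k k' w [[_ lk] _] [[_ lk'] _]; exact: exits_inj lk lk'.
apply: (@le_trans _ _ (\sum_(k < n | (k <= l + H)%N) (alpha * pr (C k) + pr (C k `&` D)))).
  by apply: ler_sum => k; exact: step.
rewrite big_split/= -mulr_sumr.
have h1 : alpha * \sum_(k < n | (k <= l + H)%N) pr (C k) <= alpha * pr B.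
  by rewrite ler_wpM2l// (le_trans C_le).
have h2 : alpha * pr B' <= alpha * pr B by rewrite ler_wpM2l.
by rewrite mulr2n !mulrDl mul1r lerD// (le_trans CD_le).
Qed.

End controlled.

(** An [i.+1]-st exit time is an exit from some [i]-th exit time, so the sum may
    be reorganised according to the latter. *)
Lemma sum_weighted_exit_time_le (w : nat -> R) i n : (forall k, 0 <= w k) ->
  \sum_(k < n) w k * pr (exit_time_event i.+1 k) <=
  \sum_(l < n) \sum_(k < n) w k * pr (exit_time_event i l `&` exit_event l k).
Proof.
move=> w0; rewrite exchange_big/=; apply: ler_sum => k _.
rewrite -mulr_sumr ler_wpM2l// exit_time_eventS.
apply: pr_bigcup_le.
  move=> l; apply: measurableI; first exact: measurable_exit_time_event.
  exact: measurable_exit_event.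
move=> l nl; apply/seteqP; split => // x [_ [lk]].
by rewrite ltnNge (leq_trans _ nl)// ltnW in lk.
Qed.

Lemma sum_exit_time_le1 i n : \sum_(k < n) pr (exit_time_event i k) <= 1.
Proof.
elim: i => [|i IH].
  rewrite -(pr_setT P); apply: (@sum_pr_disjoint_le _ _ _ P (exit_time_event 0) n predT) => //.
  - by move=> k; exact: measurable_exit_time_event.
  - by move=> a b w /= -> ->.
under eq_bigr do rewrite -[pr _]mul1r.
apply: (le_trans (@sum_weighted_exit_time_le (fun=> 1) i n (fun=> ler01))).
apply: le_trans IH; apply: ler_sum => l _; under eq_bigr do rewrite mul1r.
apply: (@sum_pr_exit_le1 _ _ _ predT); exact: measurable_exit_time_event.
Qed.

(** Give time [k] the weight [4 ^- (k %/ H.+1)] and let [W i] be the mean weight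
    of the [i]-th exit time.  The next exit either comes within [H] steps, with
    conditional probability at most 1/4, or it comes later and its weight has
    dropped by a factor 4; hence [W i.+1 <= W i / 2].  Since the weights up to
    time [n] are at least [4 ^- (n %/ H.+1)], Markov's inequality concludes. *)
Lemma many_exits_le H (alpha : R) N n : 0 <= alpha <= 8^-1 -> small_increments H alpha ->
  \sum_(k < n.+1) pr (exit_time_event N k) <= 4 ^+ (n %/ H.+1) / 2 ^+ N.
Proof.
move=> /andP[alpha0 alpha8] incr.
pose w (k : nat) : R := 4^-1 ^+ (k %/ H.+1).
have w0 k : 0 <= w k by rewrite exprn_ge0// invr_ge0.
have wle k l : (k <= l)%N -> w l <= w k.
  move=> kl; rewrite /w ler_wiXn2l ?invr_ge0//; last exact: leq_div2r.
  by rewrite invf_le1// ler1n.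
have wH l k : (l + H < k)%N -> w k <= w l / 4.
  move=> lHk; rewrite /w -exprSr ler_wiXn2l ?invr_ge0//; first by rewrite invf_le1// ler1n.
  have : ((l + H.+1) %/ H.+1 <= k %/ H.+1)%N by rewrite leq_div2r// addnS.
  by rewrite divnDr// divnn addn1.
pose W i := \sum_(k < n.+1) w k * pr (exit_time_event i k).
have WS i : W i.+1 <= W i / 2.
  apply: (le_trans (sum_weighted_exit_time_le _ _ w0)).
  rewrite /W mulr_suml; apply: ler_sum => l _.
  set B := exit_time_event i l; have pB : past Y l B by exact: past_exit_time_event.
  have mB := past_measurable pB.
  pose x k := pr (B `&` exit_event l k).
  have x0 k : 0 <= x k by exact: pr_ge0.
  apply: (@le_trans _ _ (\sum_(k < n.+1)
      (w l * (if (k <= l + H)%N then x k else 0) + w l / 4 * x k))).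
    apply: ler_sum => k _; rewrite -/(x k).
    have [lk|kl] := ltnP l k; last first.
      rewrite (_ : x k = 0); first by rewrite !mulr0 if_same mulr0 addr0.
      rewrite /x (_ : _ `&` _ = set0) ?pr_set0//.
      by apply/seteqP; split => // z [_ [lk]]; rewrite ltnNge kl in lk.
    case: leqP => [_|/wH wk].
      by rewrite ler_wpDr ?mulr_ge0 ?invr_ge0// ler_wpM2r// wle// ltnW.
    by rewrite mulr0 add0r ler_wpM2r.
  rewrite big_split/= -!mulr_sumr -big_mkcond/=.
  have h1 : \sum_(k < n.+1 | (k <= l + H)%N) x k <= 4^-1 * pr B.
    apply: (le_trans (sum_pr_exit_le alpha0 incr _ pB)).
    by rewrite ler_wpM2r ?pr_ge0//; move: alpha8; lra.
  have h2 : \sum_(k < n.+1) x k <= pr B.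
    exact: (@sum_pr_exit_le1 _ _ _ predT).
  have h3 : w l * (\sum_(k < n.+1 | (k <= l + H)%N) x k) <= w l * (4^-1 * pr B).
    by rewrite ler_wpM2l.
  have h4 : w l / 4 * \sum_(k < n.+1) x k <= w l / 4 * pr B.
    by rewrite ler_wpM2l// mulr_ge0// invr_ge0.
  apply: (le_trans (lerD h3 h4)).
  by rewrite le_eqVlt; apply/orP; left; apply/eqP; field.
have WN i : W i <= 2^-1 ^+ i.
  elim: i => [|i IH]; last by rewrite (le_trans (WS i))// exprSr ler_wpM2r// invr_ge0.
  rewrite expr0 (le_trans _ (sum_exit_time_le1 0 n.+1))//; apply: ler_sum => k _.
  by rewrite ler_piMl ?pr_ge0// (le_trans (wle 0%N k _))// /w div0n expr0.
have wn0 : 0 < w n by rewrite exprn_gt0// invr_gt0.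
have : w n * \sum_(k < n.+1) pr (exit_time_event N k) <= 2^-1 ^+ N.
  rewrite (le_trans _ (WN N))// mulr_sumr; apply: ler_sum => k _.
  by rewrite ler_wpM2r ?pr_ge0// wle// -ltnS.
rewrite mulrC -ler_pdivlMr// => /le_trans; apply.
by rewrite /w !exprVn invrK mulrC.
Qed.

(** The negations of the four hypotheses of [step_path_slowly_oscillating]:
    leaving the ball, too many exits, two exits too close to each other, and an
    exit from the final stretch. *)
Definition bad_event (n N D : nat) : set T :=
  [set w | exists2 k, (k <= n)%N & r <= enorm (Y k w)] `|`
  \bigcup_(k in `I_n.+1) exit_time_event N k `|`
  \bigcup_(i in `I_N) \bigcup_(l in `I_n.+1) \bigcup_(k in [set k | (k < n.+1)%N && (k <= l + D)%N])
    (exit_time_event i l `&` exit_event l k) `|`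
  \bigcup_(k in `I_n) exit_event (n - D.+1) k.

Lemma step_path_slowly_oscillating_off_bad n N D del w : (0 < n)%N -> 0 <= eps ->
  (D < n)%N -> del * n%:R < D.+1%:R -> ~ bad_event n N D w ->
  slowly_oscillating (step_path n (path w)) (4 * eps) del.
Proof.
move=> n0 eps0 Dn delD good.
apply: (@step_path_slowly_oscillating _ _ r eps _ _ n0 eps0 N D) => //.
- move=> k kn; rewrite ltNge; apply/negP => rk; apply: good.
  by left; left; left; exists k.
- by move=> k kn kN; apply: good; left; left; right; exists k.
- move=> i l k iN kn klD il lk; apply: good; left; right; exists i => //.
  exists l; first by case: lk => lk _ _ _ _; rewrite /= ltnS (leq_trans (ltnW lk)).
  by exists k => //=; rewrite ltnS kn klD.
- by move=> k kn lk; apply: good; right; exists k.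
Qed.

Lemma measurable_norm_ge n :
  measurable [set w | exists2 k, (k <= n)%N & r <= enorm (Y k w)].
Proof.
rewrite (_ : [set w | _] = \bigcup_(k in `I_n.+1) ~` [set w | enorm (Y k w) < r]).
  apply: bigcup_measurable => k _; apply: measurableC.
  exact: (@past_measurable _ _ _ _ _ _ Y k) (past_norm_lt _ _).
apply/seteqP; split => w [k kn h]; exists k => //.
  by apply/negP; rewrite -leNgt.
by rewrite leNgt; apply/negP.
Qed.

Lemma measurable_bad_event n N D : measurable (bad_event n N D).
Proof.
apply: measurableU; [apply: measurableU; [apply: measurableU|]|].
- exact: measurable_norm_ge.
- by apply: bigcup_measurable => k _; exact: measurable_exit_time_event.
- do 3 (apply: bigcup_measurable => ? _).
  by apply: measurableI; [exact: measurable_exit_time_event|exact: measurable_exit_event].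
- by apply: bigcup_measurable => k _; exact: measurable_exit_event.
Qed.

(** The gap after each of the [N] exits and the final stretch contribute
    [2 * alpha'] each, which explains the factor [N.+1]. *)
Lemma pr_bad_event_le n N D H (alpha alpha' : R) : (D < n)%N ->
  0 <= alpha <= 8^-1 -> small_increments H alpha ->
  0 <= alpha' -> small_increments D alpha' ->
  pr (bad_event n N D) <= pr [set w | exists2 k, (k <= n)%N & r <= enorm (Y k w)]
    + 4 ^+ (n %/ H.+1) / 2 ^+ N + N.+1%:R * (2 * alpha').
Proof.
move=> Dn a0 incr a'0 incr'.
have mbig : measurable [set w | exists2 k, (k <= n)%N & r <= enorm (Y k w)].
  exact: measurable_norm_ge.
have mN : measurable (\bigcup_(k in `I_n.+1) exit_time_event N k).
  by apply: bigcup_measurable => k _; exact: measurable_exit_time_event.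
have mIk i l k : measurable (exit_time_event i l `&` exit_event l k).
  by apply: measurableI; [exact: measurable_exit_time_event|exact: measurable_exit_event].
have mIl i l : measurable (\bigcup_(k in [set k | (k < n.+1)%N && (k <= l + D)%N])
    (exit_time_event i l `&` exit_event l k)).
  by apply: bigcup_measurable.
have mI i : measurable (\bigcup_(l in `I_n.+1) \bigcup_(k in [set k | (k < n.+1)%N && (k <= l + D)%N])
    (exit_time_event i l `&` exit_event l k)).
  by apply: bigcup_measurable.
have mgap : measurable (\bigcup_(i in `I_N) \bigcup_(l in `I_n.+1)
    \bigcup_(k in [set k | (k < n.+1)%N && (k <= l + D)%N])
    (exit_time_event i l `&` exit_event l k)).
  by apply: bigcup_measurable.
have mlast : measurable (\bigcup_(k in `I_n) exit_event (n - D.+1) k).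
  by apply: bigcup_measurable => k _; exact: measurable_exit_event.
have hN : pr (\bigcup_(k in `I_n.+1) exit_time_event N k) <= 4 ^+ (n %/ H.+1) / 2 ^+ N.
  apply: le_trans (many_exits_le N n a0 incr).
  apply: (@pr_bigcup_cond_le _ _ _ P _ n.+1 predT) => [k|k /= ->//].
  exact: measurable_exit_time_event.
have hlast : pr (\bigcup_(k in `I_n) exit_event (n - D.+1) k) <= 2 * alpha'.
  have := sum_pr_exit_le a'0 incr' n (@pastT _ _ _ _ _ P Y (n - D.+1)).
  rewrite pr_setT mulr1; apply: le_trans.
  under [leRHS]eq_bigr do rewrite setTI.
  apply: (@pr_bigcup_cond_le _ _ _ P (exit_event (n - D.+1)) n (fun k => k <= n - D.+1 + D)%N).
    by move=> k; exact: measurable_exit_event.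
  move=> k /= kn; rewrite kn/= -ltnS -addnS subnK//.
have hgap : pr (\bigcup_(i in `I_N) \bigcup_(l in `I_n.+1)
    \bigcup_(k in [set k | (k < n.+1)%N && (k <= l + D)%N])
    (exit_time_event i l `&` exit_event l k)) <= N%:R * (2 * alpha').
  apply: (le_trans (@pr_bigcup_cond_le _ _ _ P _ N predT _ mI _)) => [i /= ->//|].
  rewrite mulr_natl -[X in _ *+ X]card_ord -sumr_const; apply: ler_sum => i _.
  apply: (le_trans (@pr_bigcup_cond_le _ _ _ P _ n.+1 predT _ (mIl i) _)) => [l /= ->//|].
  apply: (@le_trans _ _ (2 * alpha' * \sum_(l < n.+1) pr (exit_time_event i l))); last first.
    by rewrite ler_piMr ?mulr_ge0//; exact: sum_exit_time_le1.
  rewrite mulr_sumr; apply: ler_sum => l _.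
  apply: le_trans (sum_pr_exit_le a'0 incr' n.+1 (@past_exit_time_event i l)).
  exact: (@pr_bigcup_cond_le _ _ _ P _ n.+1 (fun k => k <= l + D)%N _ (mIk i l)).
rewrite /bad_event -[N.+1%:R]natr1 mulrDl mul1r addrA.
rewrite (le_trans (pr_setU_le _ _ _))//; first by do 2 (apply: measurableU => //).
rewrite lerD// (le_trans (pr_setU_le _ _ _))//; first exact: measurableU.
by rewrite lerD// (le_trans (pr_setU_le _ _ _))// lerD2l.
Qed.

End exit_probabilities.

(** * The step embedding as a random path *)
Section step_path_as_function_of_values.
Context {R : realType} {d : nat}.

Lemma D01_ext (f g : D01 R d) : D01_fun f =1 D01_fun g -> f = g.
Proof.
case: f => f f1 f2 f3; case: g => g g1 g2 g3 /= /funext fg.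
by subst g; congr MkD01; exact: Prop_irrelevance.
Qed.

Lemma J1_ball_uniform (f g : D01 R d) (a e : R) : 0 <= a -> a < e ->
  (forall t, enorm (f t - g t) <= a) -> J1_ball f e g.
Proof.
move=> a0 ae fg; apply/J1_dist_ltP; exists id, a; split => //.
- exact: time_change_id.
- by move=> t; rewrite subrr normr0.
Qed.

Lemma step_path_continuous (N n : nat) (f : nat -> 'I_N) :
  continuous (fun M : 'M[R]_(N, d) => step_path n (fun k => row (f k) M)).
Proof.
move=> M; have FF : Filter (nbhs M) by exact: nbhs_filter.
move=> A /nbhs_ballP[e /= e0 eA].
have s0 : 0 < Num.sqrt d%:R + 1 :> R by rewrite ltr_wpDl// sqrtr_ge0.
apply/nbhs_ballP; exists (e / 2 / (Num.sqrt d%:R + 1)) => /=; first by rewrite !divr_gt0.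
move=> M'; rewrite -ball_normE/= => MM'; apply: eA.
apply: (@J1_ball_uniform _ _ (e / 2)); [by rewrite divr_ge0// ltW|lra|].
move=> t /=.
have rowB k : enorm (row (f k) M - row (f k) M') <= e / 2.
  rewrite (le_trans (enorm_le_norm _))//.
  apply: (@le_trans _ _ ((Num.sqrt d%:R + 1) * `|M - M'|)).
    apply: ler_pM => //; rewrite ?sqrtr_ge0//; first by rewrite lerDl.
    rewrite [leLHS]/Num.Def.normr/= mx_normrE; apply/bigmax_leP; split => // -[i j] _ /=.
    rewrite !mxE; have := coord_le_norm (M - M') (f k) j; by rewrite !mxE.
  by rewrite mulrC -ler_pdivlMr// ltW.
by rewrite /step_fun; case: ifP => _; exact: rowB.
Qed.

End step_path_as_function_of_values.

Section measurability_of_embedding.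
Context {R : realType} {d : nat}.
Context {dT : measure_display} {T : measurableType dT} {P : probability T R}.
Variables (Y : nat -> {RV P >-> borel 'rV[R]_d}) (n : nat).

Lemma measurable_chain_coord k (j : 'I_d) :
  measurable_fun setT (fun w => (Y k w : 'rV[R]_d) 0 j).
Proof.
apply: (@continuous_borel_measurable R 'rV[R]_d _ T (Y k) (fun x : 'rV[R]_d => x 0 j)).
  exact: measurable_funPT.
exact: coord_continuous.
Qed.

Lemma measurable_step_embedding_eval (t : unit_itv R) (j : 'I_d) :
  measurable_fun setT (fun w => step_embedding n Y w t 0 j).
Proof.
rewrite [X in measurable_fun _ X](_ : _ = fun w =>
  (Y (if val t < 1 then Num.truncn (n%:R * val t) else n.-1) w : 'rV[R]_d) 0 j).
  exact: measurable_chain_coord.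
by apply/funext => w; rewrite /= /step_fun; case: ifP.
Qed.

(** The step path is a J1-continuous function of the matrix of its finitely many
    values. *)
Lemma measurable_step_embedding (G : D01 R d -> R) : continuous G ->
  measurable_fun setT (G \o step_embedding n Y).
Proof.
move=> cG.
pose psi (M : 'M[R]_(n.+1, d)) := G (step_path n (fun k => row (inord k) M)).
have cpsi : continuous psi.
  move=> M; apply: (@continuous_comp _ _ _ (fun M : 'M[R]_(n.+1, d) =>
    step_path n (fun k => row (inord k) M)) G); last exact: cG.
  exact: step_path_continuous.
have -> : G \o step_embedding n Y = psi \o (fun w => \matrix_(i < n.+1) (Y i w : 'rV[R]_d)).
  apply/funext => w; rewrite /psi/=; congr G; apply: D01_ext => t /=.
  have nR0 : 0 <= n%:R :> R by [].
  have /andP[t0 t1] := unit_itvP t.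
  have rowE k : (k <= n)%N ->
      row (inord k) (\matrix_(i < n.+1) (Y i w : 'rV[R]_d)) = Y k w.
    by move=> kn; rewrite rowK inordK.
  rewrite /step_fun; case: ifP => _; rewrite rowE ?leq_pred//.
  by rewrite -(ler_nat R) (le_trans (_ : _ <= n%:R * val t))// ?truncn_le ?mulr_ge0// ler_piMr.
apply: measurable_continuous_matrix => // i j.
by under eq_fun do rewrite mxE; exact: measurable_chain_coord.
Qed.

End measurability_of_embedding.

Lemma dense_grid (R : realType) (I : set (unit_itv R)) : dense I ->
  exists p : nat -> nat -> unit_itv R, forall m k, (k < m)%N ->
    I (p m k) /\ k%:R / m%:R < val (p m k) < k.+1%:R / m%:R.
Proof.
move=> dI.
suff ex m k : exists t, (k < m)%N -> I t /\ k%:R / m%:R < val t < k.+1%:R / m%:R.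
  have [p pP] := choice (fun mk : nat * nat => ex mk.1 mk.2).
  by exists (fun m k => p (m, k)) => m k; exact: (pP (m, k)).
have [km|_] := ltnP k m; last by exists (unit_proj 0).
have m0 : 0 < m%:R :> R by rewrite ltr0n (leq_ltn_trans _ km).
pose O : set (unit_itv R) := [set t | k%:R / m%:R < val t < k.+1%:R / m%:R].
have oO : open O.
  have -> : O = (fun t : unit_itv R => val t) @^-1` [set x : R | k%:R / m%:R < x < k.+1%:R / m%:R] by [].
  apply: open_comp => [t _|]; first exact: continuous_val_unit_itv.
  rewrite (_ : [set x : R | _] = [set x | x > k%:R / m%:R] `&` [set x | x < k.+1%:R / m%:R]).
    by apply: openI; [exact: open_gt|exact: open_lt].
  by apply/seteqP; split => x /=; [move/andP|move=> [? ?]; apply/andP].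
have O0 : O !=set0.
  pose x : R := (k%:R + 2^-1) / m%:R.
  have k0 : 0 <= k%:R :> R by [].
  have km' : k%:R + 1 <= m%:R :> R by rewrite natr1 ler_nat.
  have xE : val (unit_proj x) = x.
    rewrite val_unit_proj// /x; apply/andP; split.
      by rewrite divr_ge0// addr_ge0// invr_ge0.
    by rewrite ler_pdivrMr// mul1r; lra.
  exists (unit_proj x); change (k%:R / m%:R < val (unit_proj x) < k.+1%:R / m%:R).
  by rewrite xE /x !ltr_pM2r ?invr_gt0// -[k.+1%:R]natr1; apply/andP; split; lra.
have [t [Ot It]] := dI O O0 oO.
by exists t.
Qed.

(** * Uniform slow oscillation with high probability *)
Section kernel_hypothesis.
Context {R : realType} {d : nat}.
Local Notation E := (borel 'rV[R]_d).

(** The vanishing upper limit in quantified form: [j] is the number of steps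
    made by the time [t = j / n]. *)
Lemma kernel_small (K : nat -> R.-pker E ~> E) (eps r theta : R) :
  limn_esup (fun n => ereal_sup
      [set kernel_iter (K n) (Num.truncn (t * n%:R)) x
             [set y | eps < enorm (y - x)] |
         x in [set x : 'rV[R]_d | enorm x < r] &
         t in [set t : R | 0 <= t <= h]]) @[h --> 0^'+] --> 0%E ->
  0 < theta -> exists h : R, 0 < h /\ exists n0 : nat, forall n j x,
    (n0 <= n)%N -> (0 < n)%N -> j%:R <= h * n%:R -> enorm x < r ->
    (kernel_iter (K n) j x [set y | (eps < enorm (y - x))%R] <= theta%:E)%E.
Proof.
move=> lim0 theta0.
have nbh : nbhs (0 : \bar R)%E [set z | (z < theta%:E)%E].
  by apply: open_nbhs_nbhs; split; [exact: open_ereal_lt_ereal|rewrite /= lte_fin].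
pose u (h : R) := limn_esup (fun n => ereal_sup
      [set kernel_iter (K n) (Num.truncn (t * n%:R)) x
             [set y | eps < enorm (y - x)] |
         x in [set x : 'rV[R]_d | enorm x < r] &
         t in [set t : R | 0 <= t <= h]]).
have near_u : \forall h \near 0^'+, (u h < theta%:E)%E := lim0 _ nbh.
have near_uh : \forall h \near 0^'+, (u h < theta%:E)%E /\ 0 < h.
  by apply: filterI => //; exact: nbhs_right_gt.
have [h [hlim h0]] := @filter_ex R (at_right (0 : R)) _ _ near_uh.
exists h; split => //.
move: hlim => /ereal_inf_lt[_ [V [n0 _ n0V] <-] Vtheta].
exists n0 => n j x n0n n_gt0 jh xr.
apply: le_trans (ltW Vtheta).
apply: (@le_trans _ _ (ereal_sup
      [set kernel_iter (K n) (Num.truncn (t * n%:R)) x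
             [set y | eps < enorm (y - x)] |
         x in [set x : 'rV[R]_d | enorm x < r] &
         t in [set t : R | 0 <= t <= h]])); last first.
  by apply: ereal_sup_ubound; exists n => //; exact: n0V.
have n0R : 0 < n%:R :> R by rewrite ltr0n.
apply: ereal_sup_ubound; exists x => //; exists (j%:R / n%:R).
  by rewrite /= divr_ge0//= ler_pdivrMr.
by rewrite divfK ?gt_eqF// natrK.
Qed.

Context {dT : measure_display} {T : measurableType dT} {P : probability T R}.
Variables (Y : nat -> {RV P >-> E}) (K : R.-pker E ~> E).
Hypothesis YK : is_markov_chain K Y.

Lemma kernel_small_increments (r eps alpha : R) H : 0 < eps -> 0 <= alpha ->
  (forall j x, (j <= H)%N -> enorm x < r ->
    (kernel_iter K j x [set y | (eps / 4 < enorm (y - x))%R] <= alpha%:E)%E) ->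
  small_increments Y r eps H alpha.
Proof.
move=> eps0 alpha0 Kle l j B jH pB Br.
have mB := past_measurable pB.
have mF : measurable [set w | eps / 2 < enorm ((Y (l + j)%N w : 'rV[R]_d) - Y l w)].
  by apply: (@past_measurable _ _ _ _ _ _ Y (l + j)); apply: past_far => //; exact: leq_addr.
rewrite -lee_fin EFinM !prE//; last exact: measurableI.
have e2 : 0 < eps / 2 by rewrite divr_gt0.
apply: (increment_le (r := r) YK e2 alpha0) => // x xr.
by rewrite (_ : eps / 2 / 2 = eps / 4); [exact: Kle|field].
Qed.

(** For [t] in [0, 1], [floor (t * n)] runs through [0, ..., n]. *)
Lemma running_max_gtE n (r0 : R) :
  [set w | (r0%:E < ereal_sup [set (enorm (Y (Num.truncn (t * n%:R * 1%:R)%R) w))%:E |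
           t in [set t : R | (0 <= t <= 1)%R]])%E] =
  [set w | exists2 k, (k <= n)%N & r0 < enorm (Y k w)].
Proof.
apply/seteqP; split => w /=.
  move=> /ereal_sup_gt[_ [t /andP[t0 t1] <-]]; rewrite lte_fin mulr1 => rY.
  exists (Num.truncn (t * n%:R)) => //.
  rewrite -(ler_nat R) (@le_trans _ _ (t * n%:R))// ?truncn_le ?mulr_ge0//.
  by rewrite ler_piMl.
move=> [k kn rk]; apply: (@lt_le_trans _ _ (enorm (Y k w))%:E); first by rewrite lte_fin.
apply: ereal_sup_ubound; have [n0|n0] := posnP n.
  exists 0; first by rewrite /= lexx ler01.
  by move: kn; rewrite n0 leqn0 => /eqP ->; rewrite !mul0r truncn0.
have n0R : 0 < n%:R :> R by rewrite ltr0n.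
exists (k%:R / n%:R); first by rewrite /= divr_ge0//= ler_pdivrMr// mul1r ler_nat.
by rewrite divfK ?gt_eqF// mulr1 natrK.
Qed.

Lemma measurable_norm_gt n (r0 : R) : measurable [set w | exists2 k, (k <= n)%N & r0 < enorm (Y k w)].
Proof.
rewrite (_ : [set w | _] = \bigcup_(k in `I_n.+1) [set w | r0 < enorm (Y k w)]).
  apply: bigcup_measurable => k _.
  have oB := @open_far R d 0 r0.
  have mB : measurable ([set x : 'rV[R]_d | r0 < enorm (x - 0)] : set E).
    exact: sub_sigma_algebra.
  have := @past_measurable _ _ _ _ _ _ Y k _ (past_preimage (leqnn k) mB).
  by congr measurable; apply/seteqP; split => w /=; rewrite subr0.
by apply/seteqP; split => w [k kn h]; exists k.
Qed.

End kernel_hypothesis.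

Section uniform_slow_oscillation.
Context {R : realType} {d : nat}.
Local Notation E := (borel 'rV[R]_d).
Context {dT : nat -> measure_display} {T : forall n, measurableType (dT n)}.
Variables (P : forall n, probability (T n) R) (K : nat -> R.-pker E ~> E).
Variable Y : forall n, nat -> {RV (P n) >-> E}.
Hypothesis Y_markov : forall n, (0 < n)%N -> is_markov_chain (K n) (Y n).
Hypothesis compact_containment : forall (eps : R) (m : nat), 0 < eps -> (0 < m)%N ->
  exists2 r : R, 0 < r &
    (ereal_sup
      [set P n [set w | r%:E < ereal_sup
          [set (enorm (Y n (Num.truncn (t * n%:R * m%:R)%R) w))%:E |
           t in [set t : R | (0 <= t <= 1)%R]]] |
       n in [set n | (0 < n)%N]] < eps%:E)%E.
Hypothesis no_fast_moves : forall eps r : R, 0 < eps -> 0 < r ->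
    limn_esup (fun n => ereal_sup
      [set kernel_iter (K n) (Num.truncn (t * n%:R)) x
             [set y | eps < enorm (y - x)] |
         x in [set x : 'rV[R]_d | enorm x < r] &
         t in [set t : R | 0 <= t <= h]]) @[h --> 0^'+] --> 0%E.

Lemma pr_norm_ge_small (eta : R) : 0 < eta -> exists2 r : R, 0 < r & forall n, (0 < n)%N ->
  pr (P n) [set w | exists2 k, (k <= n)%N & r <= enorm (Y n k w)] <= eta.
Proof.
move=> eta0; have [r r0 sup_lt] := compact_containment eta0 (ltn0Sn 0).
exists (r + 1); first by rewrite addr_gt0.
move=> n n0; apply: (@le_trans _ _ (pr (P n) [set w | exists2 k, (k <= n)%N & r < enorm (Y n k w)])).
  apply: le_pr; [exact: measurable_norm_ge|exact: measurable_norm_gt|].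
  by move=> w [k kn rk]; exists k => //; rewrite (lt_le_trans _ rk)// ltrDl.
rewrite -lee_fin prE; last exact: measurable_norm_gt.
apply: le_trans (ltW sup_lt); apply: ereal_sup_ubound.
by exists n => //; rewrite running_max_gtE.
Qed.

(** The order of the choices matters.  The radius [r] comes from containment.  A
    time [h1] with increment probability at most 1/8 then bounds the ratio
    [n / H] by [M], and [N] is chosen with [4 ^ M / 2 ^ N] small.  Only then
    is [h2], and with it [del], taken so small that [N.+1] windows of
    [del * n] steps have a small total probability of containing an exit. *)
Lemma slowly_oscillating_whp (e eta : R) : 0 < e -> 0 < eta ->
  exists2 del : R, 0 < del & exists n0 : nat, forall n, (n0 <= n)%N ->
    exists A : set (T n), [/\ measurable A, pr (P n) A <= eta &
      forall w, ~ A w -> slowly_oscillating (step_embedding n (Y n) w) e del].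
Proof.
move=> e0 eta0.
pose eps := e / 4.
have eps0 : 0 < eps by rewrite divr_gt0.
have eps4 : 0 < eps / 4 by rewrite divr_gt0.
have eta3 : 0 < eta / 3 by rewrite divr_gt0.
have [r r0 bigP] := pr_norm_ge_small eta3.
have e8 : 0 < 8^-1 :> R by rewrite invr_gt0.
have [h1 [h10 [n1 K1]]] := kernel_small (no_fast_moves eps4 r0) e8.
pose M := (Num.truncn h1^-1).+1.
have [N NP] : exists N : nat, 4 ^+ M / 2 ^+ N <= eta / 3 :> R.
  have c0 : 0 <= 4 ^+ M / (eta / 3) :> R by rewrite divr_ge0 ?exprn_ge0// ltW.
  exists (Num.truncn (4 ^+ M / (eta / 3))).+1.
  have p0 : 0 < 2 ^+ (Num.truncn (4 ^+ M / (eta / 3))).+1 :> R by rewrite exprn_gt0.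
  rewrite ler_pdivrMr// mulrC -ler_pdivrMr//.
  apply: (le_trans (ltW (truncnS_gt _))).
  set q := _.+1; apply: (@le_trans _ _ (2 ^ q)%:R); last by rewrite natrX.
  by rewrite ler_nat ltnW// ltn_expl.
pose theta : R := eta / (6 * N.+1%:R).
have theta0 : 0 < theta by rewrite divr_gt0// mulr_gt0.
have [h2 [h20 [n2 K2]]] := kernel_small (no_fast_moves eps4 r0) theta0.
pose del := Num.min h2 2^-1.
have del0 : 0 < del by rewrite lt_min h20 invr_gt0/=.
exists del => //; exists (maxn 1 (maxn n1 n2)) => n; rewrite !geq_max => /and3P[n0 n1n n2n].
have nR0 : 0 < n%:R :> R by rewrite ltr0n.
pose D := Num.truncn (del * n%:R).
have dn0 : 0 <= del * n%:R by rewrite mulr_ge0// ltW.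
have [Dle ltD] : D%:R <= del * n%:R /\ del * n%:R < D.+1%:R.
  by have /andP[] := truncn_itv dn0.
have delh2 : del <= h2 by rewrite ge_min lexx.
have del2 : del <= 2^-1 by rewrite ge_min lexx orbT.
have Dn : (D < n)%N.
  rewrite -(ltr_nat R) (le_lt_trans Dle)// gtr_pMl// (le_lt_trans del2)//.
  by rewrite invf_lt1// ltr1n.
pose H := Num.truncn (h1 * n%:R).
have hn0 : 0 <= h1 * n%:R by rewrite mulr_ge0// ltW.
have [Hle ltH] : H%:R <= h1 * n%:R /\ h1 * n%:R < H.+1%:R.
  by have /andP[] := truncn_itv hn0.
have YK := Y_markov n0.
have incr1 : small_increments (Y n) r eps H 8^-1.
  apply: (kernel_small_increments YK eps0 (ltW e8)) => j x jH xr.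
  by apply: K1 => //; rewrite (le_trans _ Hle)// ler_nat.
have incr2 : small_increments (Y n) r eps D theta.
  apply: (kernel_small_increments YK eps0 (ltW theta0)) => j x jD xr.
  apply: K2 => //; rewrite (@le_trans _ _ D%:R) ?ler_nat// (le_trans Dle)//.
  by rewrite ler_wpM2r// ltW.
exists (bad_event (Y n) r eps n N D); split.
- exact: measurable_bad_event.
- have a8 : 0 <= (8^-1 : R) <= 8^-1 by apply/andP; split; first exact: ltW.
  apply: (le_trans (pr_bad_event_le N Dn a8 incr1 (ltW theta0) incr2)).
  have h4 : 4 ^+ (n %/ H.+1) / 2 ^+ N <= eta / 3 :> R.
    apply: le_trans NP; rewrite ler_wpM2r ?invr_ge0 ?exprn_ge0//.
    rewrite ler_weXn2l ?ler1n// /M ltnW// ltnS.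
    have h1i : 0 <= h1^-1 by rewrite invr_ge0 ltW.
    rewrite truncn_ge_nat// -[leRHS]mul1r ler_pdivlMr//.
    have : (n %/ H.+1 * H.+1)%:R <= n%:R :> R by rewrite ler_nat leq_divM.
    rewrite natrM => nH.
    have q0 : 0 <= (n %/ H.+1)%:R :> R by [].
    have : (n %/ H.+1)%:R * (h1 * n%:R) <= n%:R.
      by apply: le_trans nH; rewrite ler_wpM2l// ltW.
    by rewrite mulrA -[leRHS]mul1r ler_pM2r.
  have h6 : N.+1%:R * (2 * theta) = eta / 3.
    have : N.+1%:R != 0 :> R by rewrite pnatr_eq0.
    by rewrite /theta; set x := N.+1%:R => x0; field.
  have h5 := bigP n n0.
  rewrite h6; rewrite [leRHS](_ : _ = eta / 3 + eta / 3 + eta / 3); last by field.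
  by rewrite lerD2r lerD.
- move=> w nA.
  have := step_path_slowly_oscillating_off_bad n0 (ltW eps0) Dn ltD nA.
  by rewrite (_ : 4 * eps = e)// /eps mulrC divfK.
Qed.

End uniform_slow_oscillation.

(** * Comparison through sampled paths *)
Lemma near_invS_lt (R : realType) (c : R) : 0 < c ->
  \forall m \near \oo, m.+1%:R^-1 < c.
Proof.
move=> c0; have c1 : 0 <= c^-1 by rewrite invr_ge0 ltW.
exists (Num.truncn c^-1) => // m /= cm.
by rewrite invf_plt ?posrE// (lt_le_trans (truncnS_gt _))// ler_nat.
Qed.

Lemma bounded_of_le (R : realType) (S : Type) (G : S -> R) (C : R) :
  (forall x, `|G x| <= C) -> [bounded G x | x in [set: S]].
Proof.
move=> GC; exists C; split; first exact: num_real.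
by move=> x Cx y _ /=; exact: le_trans (GC y) (ltW Cx).
Qed.

Section sampled_paths.
Context {R : realType} {d : nat} (p : nat -> nat -> unit_itv R).
Hypothesis pP : forall m k, (k < m)%N -> k%:R / m%:R < val (p m k) < k.+1%:R / m%:R.

(** The index is truncated to the grid by [inord], so that the step path depends
    on a matrix of [m.+1] values only; times before 1 have an index at most
    [m], and so does time 1. *)
Definition sampled (m : nat) (f : unit_itv R -> 'rV[R]_d) : D01 R d :=
  step_path m.+1 (fun k => f (p m.+1 (inord k : 'I_m.+1))).

Lemma sampled_of_matrix m (f : unit_itv R -> 'rV[R]_d) :
  step_path m.+1 (fun k => row (inord k) (\matrix_(i < m.+1) f (p m.+1 i))) =
  sampled m f.
Proof. by congr step_path; apply/funext => k; rewrite rowK. Qed.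

Lemma sampled_J1_ball m (f : D01 R d) e del r : slowly_oscillating f e del ->
  m.+1%:R^-1 < del / 2 -> e < r -> m.+1%:R^-1 < r -> J1_ball f r (sampled m f).
Proof.
move=> fed mdel er mr.
apply: (@slowly_oscillating_J1_ball _ _ m.+1 (fun k => p m.+1 (inord k : 'I_m.+1)) _ _ f e del r) => //.
  by move=> k km; rewrite inordK// pP.
by rewrite mulrC -ler_pdivlMr// ltW.
Qed.

Lemma sampled_cvg (G : D01 R d -> R) (f : D01 R d) : uniformly_continuous G ->
  G (sampled m f) @[m --> \oo] --> G f.
Proof.
move=> uG; apply/cvgrPdist_le => e e0; have [r r0 rG] := uG _ e0.
have r2 : 0 < r / 2 by rewrite divr_gt0.
have [del del0 fdel] := D01_slowly_oscillating f r2.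
have d2 : 0 < del / 2 by rewrite divr_gt0.
have rr : r / 2 < r by rewrite gtr_pMr// invf_lt1// ltr1n.
near=> m; apply: rG; apply: (sampled_J1_ball fdel) => //.
  by near: m; exact: near_invS_lt.
by near: m; exact: near_invS_lt.
Unshelve. all: by end_near. Qed.

End sampled_paths.

Section convergence.
Context {R : realType} {d : nat}.
Local Notation E := (borel 'rV[R]_d).
Context {dT : nat -> measure_display} {T : forall n, measurableType (dT n)}.
Variables (P : forall n, probability (T n) R).
Variable Y : forall n, nat -> {RV (P n) >-> E}.
Context {dT' : measure_display} {T' : measurableType dT'} (Q : probability T' R).
Variable X : {RV Q >-> borel (D01 R d)}.
Hypothesis whp : forall e eta : R, 0 < e -> 0 < eta ->
  exists2 del : R, 0 < del & exists n0 : nat, forall n, (n0 <= n)%N ->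
    exists A : set (T n), [/\ measurable A, pr (P n) A <= eta &
      forall w, ~ A w -> slowly_oscillating (step_embedding n (Y n) w) e del].
Variable I : set (unit_itv R).
Hypothesis dense_I : dense I.
Hypothesis fdd : cvg_fdd I P (fun n => step_embedding n (Y n)) Q X.

(** With [m] fixed by the precision and by [del], the means at [X] and at the
    [n]-th chain are linked by three steps: [X] to its sample, the sample of [X]
    to the sample of the chain, and that sample to the chain.  The middle one
    tends to 0 because the sample is a continuous function of the values at
    points of [I], and the last one is small off the event [A]. *)
Lemma cvg_mean_uniformly_continuous (G : D01 R d -> R) (C : R) :
  uniformly_continuous G -> (forall f, `|G f| <= C) ->
  \int[P n]_w G (step_embedding n (Y n) w) @[n --> \oo] --> \int[Q]_w G (X w).
Proof.
move=> uG GC; have cG := uniformly_continuous_continuous uG.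
have [p pP] := dense_grid dense_I.
have pI m k : (k < m)%N -> I (p m k) by move=> /pP[].
have {}pP m k : (k < m)%N -> k%:R / m%:R < val (p m k) < k.+1%:R / m%:R by move=> /pP[].
have p1 m k : (k < m)%N -> val (p m k) < 1.
  move=> km; have /andP[_ /lt_le_trans] := pP m k km; apply.
  by rewrite ler_pdivrMr ?mul1r ?ler_nat// ltr0n (leq_ltn_trans _ km).
pose phi m (M : 'M[R]_(m.+1, d)) := G (step_path m.+1 (fun k => row (inord k) M)).
have cphi m : continuous (phi m).
  move=> M; apply: (@continuous_comp _ _ _ (fun M : 'M[R]_(m.+1, d) =>
    step_path m.+1 (fun k => row (inord k) M)) G); last exact: cG.
  exact: step_path_continuous.
have phiE m (f : unit_itv R -> 'rV[R]_d) :
    phi m (\matrix_(i < m.+1) f (p m.+1 i)) = G (sampled p m f).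
  by congr G; exact: (sampled_of_matrix p).
have phiC m M : `|phi m M| <= C by exact: GC.
have mX m : measurable_fun setT (phi m \o (fun w => \matrix_(i < m.+1) (X w : D01 R d) (p m.+1 i))).
  apply: measurable_continuous_matrix => // i j.
  under eq_fun do rewrite mxE.
  by apply: measurable_eval; [exact: measurable_funPT|exact: p1].
have mXn m n : measurable_fun setT
    (phi m \o (fun w => \matrix_(i < m.+1) step_embedding n (Y n) w (p m.+1 i))).
  apply: measurable_continuous_matrix => // i j.
  by under eq_fun do rewrite mxE; exact: measurable_step_embedding_eval.
have mGX : measurable_fun setT (fun w => G (X w)).
  by apply: (@continuous_borel_measurable _ (D01 R d) _ _ X G) => //; exact: measurable_funPT.
have mGXn n : measurable_fun setT (fun w => G (step_embedding n (Y n) w)).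
  exact: measurable_step_embedding.
have fdd_m m : \int[P n]_w G (sampled p m (step_embedding n (Y n) w)) @[n --> \oo] -->
    \int[Q]_w G (sampled p m (X w : D01 R d)).
  have := fdd (fun i => pI m.+1 i (ltn_ord i)) (cphi m) (bounded_of_le (phiC m)).
  rewrite (expectation_bounded _ (mX m) (fun w => phiC m _)).
  under eq_fun do rewrite (expectation_bounded _ (mXn m _) (fun w => phiC m _)).
  have -> : \int[Q]_w (phi m \o (fun w => \matrix_(i < m.+1) (X w : D01 R d) (p m.+1 i))) w =
      \int[Q]_w G (sampled p m (X w : D01 R d)).
    by apply: eq_Rintegral => w _; exact: phiE.
  have EXn n : \int[P n]_w (phi m \o (fun w => \matrix_(i < m.+1)
        step_embedding n (Y n) w (p m.+1 i))) w =
      \int[P n]_w G (sampled p m (step_embedding n (Y n) w)).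
    by apply: eq_Rintegral => w _; exact: phiE.
  under eq_fun do rewrite EXn.
  by move=> /fine_cvg.
have mGsX m : measurable_fun setT (fun w => G (sampled p m (X w : D01 R d))).
  rewrite [X in measurable_fun _ X](_ : _ =
    (phi m \o (fun w => \matrix_(i < m.+1) (X w : D01 R d) (p m.+1 i)))); first exact: mX.
  by apply/funext => w; rewrite -phiE.
have mGsXn m n : measurable_fun setT (fun w => G (sampled p m (step_embedding n (Y n) w))).
  rewrite [X in measurable_fun _ X](_ : _ =
    (phi m \o (fun w => \matrix_(i < m.+1) step_embedding n (Y n) w (p m.+1 i)))); first exact: mXn.
  by apply/funext => w; rewrite -phiE.
have sampled_X : \int[Q]_w G (sampled p m (X w : D01 R d)) @[m --> \oo] --> \int[Q]_w G (X w).
  apply: (@cvg_mean _ _ _ Q _ _ C) => //.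
  by move=> w; exact: sampled_cvg.
apply/cvgrPdist_le => e e0.
(* four parts e / 4: one for each of the first two steps, and for the third one
   the modulus of continuity of G and the exceptional event *)
have C0 : 0 <= C by rewrite (le_trans _ (GC (cst_D01 0))).
have e4 : 0 < e / 4 by rewrite divr_gt0.
have [r r0 rG] := uG _ e4.
have r2 : 0 < r / 2 by rewrite divr_gt0.
have rr : r / 2 < r by rewrite gtr_pMr// invf_lt1// ltr1n.
pose eta : R := e / 4 / (2 * C + 1).
have C1 : 0 < 2 * C + 1 by rewrite ltr_wpDl// mulr_ge0.
have eta0 : 0 < eta by rewrite divr_gt0.
have Ceta : 2 * C * eta <= e / 4.
  by rewrite /eta mulrCA ler_piMr ?ltW// ltr_pdivrMr// mul1r ltrDl.
have [del del0 [n0 osc]] := whp r2 eta0.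
have d2 : 0 < del / 2 by rewrite divr_gt0.
have [m [m1 m2 m3]] : exists m, [/\ m.+1%:R^-1 < del / 2, m.+1%:R^-1 < r &
    `|\int[Q]_w G (X w) - \int[Q]_w G (sampled p m (X w : D01 R d))| <= e / 4].
  suff : \forall m \near \oo, [/\ m.+1%:R^-1 < del / 2, m.+1%:R^-1 < r &
      `|\int[Q]_w G (X w) - \int[Q]_w G (sampled p m (X w : D01 R d))| <= e / 4].
    by move=> /filter_ex.
  have /cvgrPdist_le/(_ _ e4) sX := sampled_X.
  near=> m; split; near: m; [exact: near_invS_lt|exact: near_invS_lt|exact: sX].
have /cvgrPdist_le/(_ _ e4) fm := fdd_m m.
near=> n.
have n0n : (n0 <= n)%N by near: n; exact: nbhs_infty_ge.
have m4 : `|\int[Q]_w G (sampled p m (X w : D01 R d)) -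
    \int[P n]_w G (sampled p m (step_embedding n (Y n) w))| <= e / 4.
  by near: n; exact: fm.
have [A [mA PA oscA]] := osc n n0n.
have m5 : `|\int[P n]_w G (step_embedding n (Y n) w) -
    \int[P n]_w G (sampled p m (step_embedding n (Y n) w))| <= e / 4 + 2 * C * pr (P n) A.
  apply: dist_mean_le => //; last exact: ltW.
  move=> w nA; apply: rG.
  exact: (sampled_J1_ball pP (oscA w nA) m1 rr m2).
have m6 : 2 * C * pr (P n) A <= e / 4.
  by rewrite (le_trans _ Ceta)// ler_wpM2l// mulr_ge0.
have -> : e = e / 4 + (e / 4 + (e / 4 + e / 4)) by field.
rewrite (le_trans (ler_distD _ _ _) (lerD m3 _))//.
rewrite (le_trans (ler_distD _ _ _) (lerD m4 _))//.
by rewrite distrC (le_trans m5)// lerD2l.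
Unshelve. all: by end_near. Qed.

End convergence.

Theorem theorem4p6 (R : realType) (d : nat) (d_gt0 : (0 < d)%N)
    (dT : nat -> measure_display) (T : forall n, measurableType (dT n))
    (P : forall n, probability (T n) R)
    (K : nat -> R.-pker borel 'rV[R]_d ~> borel 'rV[R]_d)
    (Y : forall n, nat -> {RV (P n) >-> borel 'rV[R]_d})
    (Y_markov : forall n, (0 < n)%N -> is_markov_chain (K n) (Y n))
    (dT' : measure_display) (T' : measurableType dT') (Q : probability T' R)
    (X : {RV Q >-> borel (D01 R d)}) :
  (exists2 I : set (unit_itv R), dense I &
    cvg_fdd I P (fun n => step_embedding n (Y n)) Q X) ->
  (forall (eps : R) (m : nat), 0 < eps -> (0 < m)%N -> exists2 r : R, 0 < r &
    (ereal_sup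
      [set P n [set w | r%:E < ereal_sup
          [set (enorm (Y n (Num.truncn (t * n%:R * m%:R)%R) w))%:E |
           t in [set t : R | (0 <= t <= 1)%R]]] |
       n in [set n | (0 < n)%N]] < eps%:E)%E) ->
  (forall eps r : R, 0 < eps -> 0 < r ->
    limn_esup (fun n => ereal_sup
      [set kernel_iter (K n) (Num.truncn (t * n%:R)) x
             [set y | eps < enorm (y - x)] |
         x in [set x : 'rV[R]_d | enorm x < r] &
         t in [set t : R | 0 <= t <= h]]) @[h --> 0^'+] --> 0%E) ->
  cvg_in_law P (fun n => step_embedding n (Y n)) Q X.
Proof.
move=> [I dI fdd] containment no_fast_moves.
apply: cvg_in_law_uniformly_continuous => [n G cG|G cG|G C uG GC].
- exact: measurable_step_embedding.
- exact: (@continuous_borel_measurable _ (D01 R d) _ _ X G).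
- apply: (cvg_mean_uniformly_continuous _ dI fdd uG GC) => e eta e0 eta0.
  exact: (slowly_oscillating_whp Y_markov containment no_fast_moves e0 eta0).
Qed.
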